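(* Let $\rho,\sigma$ be two 1-arrows from an object $A$ to an object $B$ of a 2-$C^*$-category closed under projections, direct sums and conjugation, and let $R_\rho,\bar R_\rho$ be a solution of the conjugation equations for $\rho$. For $T,S\in \mathrm{Hom}(\rho,\sigma)$ put $\langle T,S\rangle := R_\rho^*\circ(1_{\bar\rho}\otimes(S^*\circ T))\circ R_\rho\in \mathrm{End}(\iota_A)\cong C(\Omega_A)$. For $\omega\in\Omega_A$ let $\mathrm{Hom}(\rho,\sigma)_\omega$ be the Hilbert space obtained by separation and completion of $\mathrm{Hom}(\rho,\sigma)$ with respect to the semi-inner product $(T,S)\mapsto\langle T,S\rangle(\omega)$, and write $T_{|\omega}$ for the image of $T$ in it. Then $\mathrm{Hom}(\rho,\sigma)$ has the structure of a Hilbert bundle over $\Omega_A$: the family $\{\mathrm{Hom}(\rho,\sigma)_\omega\}_{\omega\in\Omega_A}$, together with the set of continuous sections $\Gamma=\{(T_{|\omega})_{\omega\in\Omega_A}: T\in \mathrm{Hom}(\rho,\sigma)\}$, is a Hilbert bundle over $\Omega_A$, and $T\mapsto (T_{|\omega})_\omega$ is a linear bijection of $\mathrm{Hom}(\rho,\sigma)$ onto $\Gamma$.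
   Context: A 2-$C^*$-category is a strict 2-category (1-arrows $B\xleftarrow{\rho}A$ composed by $\otimes$, with unit 1-arrows $\iota_A$; 2-arrows $S\in\mathrm{Hom}(\rho,\sigma)$ between parallel 1-arrows, with vertical composition $\circ$, units $1_\rho$, and horizontal composition $\otimes$; $\mathrm{End}(\rho)=\mathrm{Hom}(\rho,\rho)$) such that every $\mathrm{Hom}(\rho,\sigma)$ is a complex Banach space, compositions are bilinear, there is an antilinear involution $*:\mathrm{Hom}(\rho,\sigma)\to\mathrm{Hom}(\sigma,\rho)$ with $(S\circ T)^*=T^*\circ S^*$ and $(S\otimes T)^*=S^*\otimes T^*$, $\|T\circ S\|\le\|T\|\|S\|$, $\|S^*\circ S\|=\|S\|^2$, and $S^*\circ S$ is positive in $\mathrm{End}(\rho)$ for $S\in\mathrm{Hom}(\rho,\sigma)$. Then $\mathrm{End}(\rho)$ is a unital $C^*$-algebra, and $\mathrm{End}(\iota_A)$ is commutative, identified with $C(\Omega_A)$, $\Omega_A$ compact Hausdorff; units are not assumed simple. Closed under projections: for each projection $P\in\mathrm{End}(\rho)$ there are a 1-arrow $\rho_P$ and $W\in\mathrm{Hom}(\rho_P,\rho)$ with $W^*\circ W=1_{\rho_P}$, $W\circ W^*=P$. Closed under direct sums: for parallel $\rho_1,\rho_2$ there are $\rho$ and $W_i\in\mathrm{Hom}(\rho_i,\rho)$ with $W_i^*\circ W_j=\delta_{ij}1_{\rho_i}$, $W_1\circ W_1^*+W_2\circ W_2^*=1_\rho$. Closed under conjugation: for each $B\xleftarrow{\rho}A$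 there are $A\xleftarrow{\bar\rho}B$ and $R_\rho\in\mathrm{Hom}(\iota_A,\bar\rho\otimes\rho)$, $\bar R_\rho\in\mathrm{Hom}(\iota_B,\rho\otimes\bar\rho)$ (a solution of the conjugation equations) with $(\bar R_\rho^*\otimes1_\rho)\circ(1_\rho\otimes R_\rho)=1_\rho$, $(R_\rho^*\otimes1_{\bar\rho})\circ(1_{\bar\rho}\otimes\bar R_\rho)=1_{\bar\rho}$. A Banach bundle over a compact Hausdorff space $\Omega$ is a family of Banach spaces $\{E_\omega,\|\cdot\|^\omega\}_{\omega\in\Omega}$ with a set $\Gamma\subset\prod_\omega E_\omega$ (continuous sections) such that: (i) $\Gamma$ is a linear subspace; (ii) for all $\omega$, $\{S_{|\omega}:S\in\Gamma\}$ is dense in $E_\omega$; (iii) for all $S\in\Gamma$, $\omega\mapsto\|S_{|\omega}\|^\omega$ is continuous; (iv) if $X\in\prod_\omega E_\omega$ is such that for all $\omega$ and $\epsilon>0$ there is $S\in\Gamma$ with $\|X_{|\omega'}-S_{|\omega'}\|^{\omega'}<\epsilon$ for $\omega'$ in a neighbourhood of $\omega$, then $X\in\Gamma$. It is a Hilbert bundle if the $E_\omega$ are Hilbert spaces with norms given by the inner products. *)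

(* Defs.v *)
(* MathComp-Analysis; the complex numbers are R[i] = complex R for an
   arbitrary R : realType. *)
From HB Require Import structures.
From mathcomp Require Import all_boot all_order all_algebra.
From mathcomp Require Import complex.
From mathcomp Require Import all_classical all_reals all_analysis.

Set Implicit Arguments.
Unset Strict Implicit.
Unset Printing Implicit Defensive.

Import Order.TTheory GRing.Theory Num.Theory.
Import numFieldNormedType.Exports.

Local Open Scope classical_set_scope.
Local Open Scope ring_scope.

(* In a strict 2-category, r ⊗ (s ⊗ t) and (r ⊗ s) ⊗ t are equal but not
   convertible; 2-arrows are transported along such equalities by hcast. *)
Definition hcast (X : Type) (H : X -> X -> Type) (x x' y y' : X)
    (ex : x = x') (ey : y = y') (f : H x y) : H x' y' :=
  match ex in _ = u, ey in _ = v return H u v with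
  | erefl, erefl => f
  end.
Arguments hcast {X} H {x x' y y'} ex ey f.

(* arr1 A B is the type of 1-arrows from A to B.  As in the usual notation
   C <-r- B <-s- A, the composite of r : arr1 B C and s : arr1 A B is
   tens1 r s : arr1 A C.  Since the scalars are complex, the norm takes its
   values in the nonnegative real elements of R[i]. *)
Record twoCstarCategory (R : realType) := TwoCstarCategory {
  obj : Type;
  arr1 : obj -> obj -> Type;
  arr2 : forall A B : obj,
    arr1 A B -> arr1 A B -> completeNormedModType (complex R);

  unit1 : forall A : obj, arr1 A A;
  tens1 : forall A B C : obj, arr1 B C -> arr1 A B -> arr1 A C;
  id2 : forall (A B : obj) (r : arr1 A B), arr2 r r;
  vcomp : forall (A B : obj) (r s t : arr1 A B),
    arr2 s t -> arr2 r s -> arr2 r t;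
  tens2 : forall (A B C : obj) (r r' : arr1 B C) (s s' : arr1 A B),
    arr2 r r' -> arr2 s s' -> arr2 (tens1 r s) (tens1 r' s');
  star : forall (A B : obj) (r s : arr1 A B), arr2 r s -> arr2 s r;

  tens1A : forall (A B C D : obj)
      (r : arr1 C D) (s : arr1 B C) (t : arr1 A B),
    tens1 r (tens1 s t) = tens1 (tens1 r s) t;
  tens11r : forall (A B : obj) (r : arr1 A B), tens1 (unit1 B) r = r;
  tens1r1 : forall (A B : obj) (r : arr1 A B), tens1 r (unit1 A) = r;

  vcompA : forall (A B : obj) (r s t u : arr1 A B)
      (S : arr2 t u) (T : arr2 s t) (U : arr2 r s),
    vcomp S (vcomp T U) = vcomp (vcomp S T) U;
  vcomp1l : forall (A B : obj) (r s : arr1 A B) (S : arr2 r s),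
    vcomp (id2 s) S = S;
  vcomp1r : forall (A B : obj) (r s : arr1 A B) (S : arr2 r s),
    vcomp S (id2 r) = S;

  tens2A : forall (A B C D : obj) (r r' : arr1 C D) (s s' : arr1 B C)
      (t t' : arr1 A B) (S : arr2 r r') (T : arr2 s s') (U : arr2 t t'),
    hcast (@arr2 A D) (tens1A r s t) (tens1A r' s' t')
      (tens2 S (tens2 T U)) = tens2 (tens2 S T) U;
  tens21l : forall (A B : obj) (r s : arr1 A B) (S : arr2 r s),
    hcast (@arr2 A B) (tens11r r) (tens11r s)
      (tens2 (id2 (unit1 B)) S) = S;
  tens21r : forall (A B : obj) (r s : arr1 A B) (S : arr2 r s),
    hcast (@arr2 A B) (tens1r1 r) (tens1r1 s)
      (tens2 S (id2 (unit1 A))) = S;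
  tens2_id : forall (A B C : obj) (r : arr1 B C) (s : arr1 A B),
    tens2 (id2 r) (id2 s) = id2 (tens1 r s);
  tens2_vcomp : forall (A B C : obj) (r r' r'' : arr1 B C)
      (s s' s'' : arr1 A B) (S' : arr2 r' r'') (S : arr2 r r')
      (T' : arr2 s' s'') (T : arr2 s s'),
    tens2 (vcomp S' S) (vcomp T' T) = vcomp (tens2 S' T') (tens2 S T);

  vcomp_linearl : forall (A B : obj) (r s t : arr1 A B) (S : arr2 r s),
    linear (fun T : arr2 s t => vcomp T S);
  vcomp_linearr : forall (A B : obj) (r s t : arr1 A B) (T : arr2 s t),
    linear (fun S : arr2 r s => vcomp T S);
  tens2_linearl : forall (A B C : obj) (r r' : arr1 B C) (s s' : arr1 A B)
      (T : arr2 s s'),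
    linear (fun S : arr2 r r' => tens2 S T);
  tens2_linearr : forall (A B C : obj) (r r' : arr1 B C) (s s' : arr1 A B)
      (S : arr2 r r'),
    linear (fun T : arr2 s s' => tens2 S T);

  star_antilinear : forall (A B : obj) (r s : arr1 A B)
      (a : complex R) (S T : arr2 r s),
    star (a *: S + T) = Num.conj a *: star S + star T;
  starK : forall (A B : obj) (r s : arr1 A B) (S : arr2 r s),
    star (star S) = S;
  star_vcomp : forall (A B : obj) (r s t : arr1 A B)
      (S : arr2 s t) (T : arr2 r s),
    star (vcomp S T) = vcomp (star T) (star S);
  star_tens2 : forall (A B C : obj) (r r' : arr1 B C) (s s' : arr1 A B)
      (S : arr2 r r') (T : arr2 s s'),
    star (tens2 S T) = tens2 (star S) (star T);

  norm_vcomp : forall (A B : obj) (r s t : arr1 A B)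
      (T : arr2 s t) (S : arr2 r s),
    `|vcomp T S| <= `|T| * `|S|;
  norm_star_vcomp : forall (A B : obj) (r s : arr1 A B) (S : arr2 r s),
    `|vcomp (star S) S| = `|S| ^+ 2;
  (* the positive elements of the C*-algebra End(r) are the X^* ∘ X with
     X in End(r); here S need not be an endomorphism *)
  star_vcomp_pos : forall (A B : obj) (r s : arr1 A B) (S : arr2 r s),
    exists X : arr2 r r, vcomp (star S) S = vcomp (star X) X
}.

Arguments arr1 {R} CC _ _ : rename.
Arguments arr2 {R CC A B} _ _ : rename.
Arguments unit1 {R CC} A : rename.
Arguments tens1 {R CC A B C} _ _ : rename.
Arguments id2 {R CC A B} r : rename.
Arguments vcomp {R CC A B r s t} _ _ : rename.
Arguments tens2 {R CC A B C r r' s s'} _ _ : rename.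
Arguments star {R CC A B r s} _ : rename.
Arguments tens1A {R CC A B C D} r s t : rename.
Arguments tens11r {R CC A B} r : rename.
Arguments tens1r1 {R CC A B} r : rename.

Definition closed_under_projections (R : realType)
    (CC : twoCstarCategory R) : Prop :=
  forall (A B : obj CC) (r : arr1 CC A B) (P : arr2 r r),
    vcomp P P = P -> star P = P ->
    exists (rP : arr1 CC A B) (W : arr2 rP r),
      vcomp (star W) W = id2 rP /\ vcomp W (star W) = P.

Definition closed_under_direct_sums (R : realType)
    (CC : twoCstarCategory R) : Prop :=
  forall (A B : obj CC) (r1 r2 : arr1 CC A B),
    exists (r : arr1 CC A B) (W1 : arr2 r1 r) (W2 : arr2 r2 r),
      [/\ vcomp (star W1) W1 = id2 r1, vcomp (star W2) W2 = id2 r2,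
          vcomp (star W1) W2 = 0, vcomp (star W2) W1 = 0 &
          vcomp W1 (star W1) + vcomp W2 (star W2) = id2 r].

Definition conjugation_equations (R : realType) (CC : twoCstarCategory R)
    (A B : obj CC) (r : arr1 CC A B) (rb : arr1 CC B A)
    (Rr : arr2 (unit1 A) (tens1 rb r)) (Rb : arr2 (unit1 B) (tens1 r rb)) :
    Prop :=
  vcomp (hcast arr2 (esym (tens1A r rb r)) (tens11r r)
           (tens2 (star Rb) (id2 r)))
        (hcast arr2 (tens1r1 r) erefl (tens2 (id2 r) Rr)) = id2 r
  /\
  vcomp (hcast arr2 (esym (tens1A rb r rb)) (tens11r rb)
           (tens2 (star Rr) (id2 rb)))
        (hcast arr2 (tens1r1 rb) erefl (tens2 (id2 rb) Rb)) = id2 rb.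

Definition closed_under_conjugation (R : realType)
    (CC : twoCstarCategory R) : Prop :=
  forall (A B : obj CC) (r : arr1 CC A B),
    exists (rb : arr1 CC B A) (Rr : arr2 (unit1 A) (tens1 rb r))
           (Rb : arr2 (unit1 B) (tens1 r rb)),
      conjugation_equations Rr Rb.

(* Omega_A is the Gelfand spectrum of the commutative C*-algebra
   End(iota_A): its characters with the topology of pointwise convergence.
   Under End(iota_A) = C(Omega_A), the value at w of a is w(a). *)
Definition is_character (R : realType) (CC : twoCstarCategory R)
    (A : obj CC) (chi : arr2 (unit1 A) (unit1 A) -> complex R) : Prop :=
  [/\ forall (a : complex R) (S T : arr2 (unit1 A) (unit1 A)),
        chi (a *: S + T) = a * chi S + chi T,
      forall S T : arr2 (unit1 A) (unit1 A),
        chi (vcomp S T) = chi S * chi T &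
      chi (id2 (unit1 A)) = 1].

Definition characters (R : realType) (CC : twoCstarCategory R)
    (A : obj CC) :
    set {ptws arr2 (unit1 A) (unit1 A) -> (complex R)^o} :=
  [set chi | is_character chi].

Definition spectrum (R : realType) (CC : twoCstarCategory R)
    (A : obj CC) : topologicalType :=
  initial_topology (@set_val _ (@characters R CC A)).

Definition spec_eval (R : realType) (CC : twoCstarCategory R) (A : obj CC)
    (a : arr2 (unit1 A) (unit1 A)) (w : spectrum A) : complex R :=
  set_val (w : @characters R CC A) a.

Definition hom_inner (R : realType) (CC : twoCstarCategory R)
    (A B : obj CC) (r s : arr1 CC A B) (rb : arr1 CC B A)
    (Rr : arr2 (unit1 A) (tens1 rb r)) (T S : arr2 r s) :
    arr2 (unit1 A) (unit1 A) :=
  vcomp (star Rr) (vcomp (tens2 (id2 rb) (vcomp (star S) T)) Rr).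

Record hilbertSpace (R : realType) := HilbertSpace {
  hcarrier :> completeNormedModType (complex R);
  hdot : {dot hcarrier for (@Num.conj (complex R))};
  hnormE : forall x : hcarrier, `|x| ^+ 2 = hdot x x
}.

(* A Hilbert space obtained from V by separation and completion with respect
   to form, together with the canonical map; these data determine the
   Hilbert space and the map up to a unique unitary. *)
Record hilbertCompletion (R : realType) (V : lmodType (complex R))
    (form : V -> V -> complex R) := HilbertCompletion {
  hc_space :> hilbertSpace R;
  hc_map : {linear V -> hc_space};
  hc_dot : forall x y : V, hdot hc_space (hc_map x) (hc_map y) = form x y;
  hc_dense : dense (range hc_map)
}.

Record is_banach_bundle (R : realType) (Omega : topologicalType)
    (E : Omega -> completeNormedModType (complex R))
    (Gamma : set (forall w : Omega, E w)) : Prop := IsBanachBundle {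
  bb_compact : compact [set: Omega];
  bb_hausdorff : hausdorff_space Omega;
  bb_zero : Gamma (fun w => 0);
  bb_linear : forall (a : complex R) (X Y : forall w, E w),
    Gamma X -> Gamma Y -> Gamma (fun w => a *: X w + Y w);
  bb_dense : forall w : Omega, dense [set X w | X in Gamma];
  bb_norm : forall X : forall w, E w, Gamma X ->
    continuous (fun w : Omega => `|X w| : (complex R)^o);
  bb_local : forall X : forall w, E w,
    (forall (w : Omega) (e : R), 0 < e ->
       exists2 S : forall w, E w, Gamma S &
         \forall w' \near w, `|X w' - S w'| < (real_complex R) e) ->
    Gamma X
}.

(* A Banach bundle whose fibres are Hilbert spaces; hnormE makes the norms
   those given by the inner products. *)
Definition is_hilbert_bundle (R : realType) (Omega : topologicalType)
    (E : Omega -> hilbertSpace R) (Gamma : set (forall w : Omega, E w)) :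
    Prop :=
  @is_banach_bundle R Omega (fun w => hcarrier (E w)) Gamma.

Definition hom_fibre (R : realType) (CC : twoCstarCategory R)
    (A B : obj CC) (r s : arr1 CC A B) (rb : arr1 CC B A)
    (Rr : arr2 (unit1 A) (tens1 rb r)) (w : spectrum A) :=
  @hilbertCompletion R (arr2 r s)
    (fun T S => spec_eval (hom_inner Rr T S) w).

Definition hom_section (R : realType) (CC : twoCstarCategory R)
    (A B : obj CC) (r s : arr1 CC A B) (rb : arr1 CC B A)
    (Rr : arr2 (unit1 A) (tens1 rb r))
    (H : forall w : spectrum A, hom_fibre s Rr w) (T : arr2 r s) :
    forall w : spectrum A, H w :=
  fun w => hc_map (H w) T.

(* Main.v *)
(** Write E = End(iota_A).  It is a commutative ring (Eckmann-Hilton), and the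
    set P of its elements X^* X is a cone stable under products, because sums
    S^* S + T^* T are of the form V^* V for V with values in a direct sum.
    A function-theoretic picture of E is obtained from P by real algebra: if b
    is hermitian and not in P, a maximal preordering containing P and -b totally
    orders the hermitian elements, and reading off the standard part gives a
    character with value <= 0 at b (Kadison-Dubois).  Hence a hermitian element
    that is positive at all characters lies in P; the norm of E is the supremum
    over characters because S^* S + T^* T = m implies |S|^2 <= m.

    Put X_T = (1 (x) T) R, so that <T, T> = X_T^* X_T.  The conjugation equations
    give T = (Rb^* (x) 1)(1 (x) X_T), so |T| is equivalent to |X_T|, that is, to
    the supremum over w of the norms of T in the fibres.  Moreover E acts on
    Hom(rho, sigma) with X_{Ta} = X_T a.  Multiplying by
    (e^2 + d(w)) / (e^2 + d), d = <D, D>, one lifts Cauchy sequences of a fibre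
    to Hom(rho, sigma); so the separated quotients are already complete.
    Sections that are locally uniform limits are globalized by a partition of
    unity in E, up to e, and converge in Hom(rho, sigma) by the norm
    equivalence. *)
Require Import Defs.
From HB Require Import structures.
From mathcomp Require Import all_boot all_order all_algebra.
From mathcomp Require Import complex.
From mathcomp Require Import all_classical all_reals all_analysis.
From mathcomp Require Import ring lra.

Set Implicit Arguments.
Unset Strict Implicit.
Unset Printing Implicit Defensive.

Import Order.TTheory GRing.Theory Num.Theory.
Import numFieldNormedType.Exports.

Local Open Scope classical_set_scope.
Local Open Scope ring_scope.

(** * Real-valued norms and geometric convergence *)

Section RealNorm.
Context {R : realType}.
Local Notation C := (complex R).
Local Notation "x %:C" := (real_complex R x) : ring_scope.

(** Norms take values in [R[i]]; their real parts live in the totally ordered field [R], where order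
    lemmas and [lra] apply. *)
Definition rnorm (V : normedZmodType C) (x : V) : R := complex.Re `|x|.

Lemma rnormE (V : normedZmodType C) (x : V) : `|x| = (rnorm x)%:C.
Proof. by rewrite /rnorm RRe_real // normr_real. Qed.

Lemma rnorm_ge0 (V : normedZmodType C) (x : V) : 0 <= rnorm x.
Proof. by rewrite -lecR -rnormE normr_ge0. Qed.

Lemma rnorm0 (V : normedZmodType C) : rnorm (0 : V) = 0.
Proof. by apply: complexI; rewrite -rnormE normr0. Qed.

Lemma rnorm0_eq0 (V : normedZmodType C) (x : V) : rnorm x <= 0 -> x = 0.
Proof.
move=> h; apply/eqP; rewrite -normr_eq0 rnormE.
by have -> : rnorm x = 0 by apply: le_anti; rewrite h rnorm_ge0.
Qed.

Lemma rnorm_eq0 (V : normedZmodType C) (x : V) : rnorm x = 0 -> x = 0.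
Proof. by move=> h; apply: rnorm0_eq0; rewrite h. Qed.

Lemma rnormD (V : normedZmodType C) (x y : V) :
  rnorm (x + y) <= rnorm x + rnorm y.
Proof. by rewrite -lecR rmorphD/= -!rnormE ler_normD. Qed.

Lemma rnormN (V : normedZmodType C) (x : V) : rnorm (- x) = rnorm x.
Proof. by apply: complexI; rewrite -!rnormE normrN. Qed.

Lemma rnormB (V : normedZmodType C) (x y : V) : rnorm (x - y) = rnorm (y - x).
Proof. by rewrite -rnormN opprB. Qed.

Lemma rnormZ (V : normedModType C) (a : C) (x : V) :
  rnorm (a *: x) = rnorm a * rnorm x.
Proof. by apply: complexI; rewrite rmorphM/= -!rnormE normrZ. Qed.

Lemma rnormM (a b : C) : rnorm (a * b) = rnorm a * rnorm b.
Proof. by apply: complexI; rewrite rmorphM/= -!rnormE normrM. Qed.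

Lemma rnorm_real (r : R) : rnorm (r%:C) = `|r|.
Proof.
apply: complexI; rewrite -rnormE.
by rewrite normc_def /= expr0n /= addr0 sqrtr_sqr.
Qed.

Lemma rnorm_sum (V : normedZmodType C) (I : Type) (s : seq I) (F : I -> V) :
  rnorm (\sum_(i <- s) F i) <= \sum_(i <- s) rnorm (F i).
Proof.
elim: s => [|i s IH]; first by rewrite !big_nil rnorm0.
by rewrite !big_cons (le_trans (rnormD _ _))// lerD2l.
Qed.

Lemma geometric_dist (V : normedZmodType C) (u : nat -> V) (c q : R) :
  0 <= q -> q < 1 -> (forall n, rnorm (u n.+1 - u n) <= c * q ^+ n) ->
  forall n m, rnorm (u (n + m)%N - u n) <= c * q ^+ n / (1 - q).
Proof.
move=> q0 q1 hu n m.
have c0 : 0 <= c by have := hu 0%N; rewrite expr0 mulr1; apply: le_trans; exact: rnorm_ge0.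
have q1' : 0 < 1 - q by rewrite subr_gt0.
(* The induction needs the exact partial geometric sum, whence the extra factor [1 - q ^+ m]. *)
suff : rnorm (u (n + m)%N - u n) <= c * q ^+ n * (1 - q ^+ m) / (1 - q).
  move/le_trans; apply; rewrite ler_pM2r ?invr_gt0//.
  by rewrite ler_piMr ?mulr_ge0 ?exprn_ge0// gerBl exprn_ge0.
elim: m => [|m IH]; first by rewrite addn0 subrr rnorm0 expr0 subrr mulr0 mul0r.
rewrite addnS -(subrKA (u (n + m)%N)) (le_trans (rnormD _ _))//.
rewrite (le_trans (lerD (hu _) IH))// le_eqVlt; apply/orP; left; apply/eqP.
by rewrite exprD exprS; field; rewrite gt_eqF.
Qed.

Lemma geometric_lt (q e c : R) : 0 <= q -> q < 1 -> 0 < e ->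
  exists n, c * q ^+ n < e.
Proof.
move=> q0 q1 e0.
have /cvgrPdist_lt h : (fun n => c * q ^+ n) @ \oo --> (0 : R).
  by rewrite -(mulr0 c); apply: cvgMr; apply: cvg_expr; rewrite ger0_norm.
have [N _ /(_ N (leqnn N))] := h _ e0.
rewrite /= sub0r normrN => h1; exists N; apply: le_lt_trans h1; exact: ler_norm.
Qed.

Lemma rnorm_closure (V : normedZmodType C) (x : V) (e : R) :
  (forall d, 0 < d -> rnorm x <= e + d) -> rnorm x <= e.
Proof. by move=> h; apply/ler_addgt0Pr => d /h. Qed.

Lemma geometric_cvg (V : completeNormedModType C) (u : nat -> V) (c q : R) :
  0 <= q -> q < 1 -> (forall n, rnorm (u n.+1 - u n) <= c * q ^+ n) ->
  exists l, forall n, rnorm (l - u n) <= c * q ^+ n / (1 - q).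
Proof.
move=> q0 q1 hu; have q1' : 0 < 1 - q by rewrite subr_gt0.
have hd := geometric_dist q0 q1 hu.
have cu : cauchy (u @ \oo).
  apply/cauchy_exP => e e0.
  have eE : e = (complex.Re e)%:C by rewrite RRe_real ?gtr0_real.
  have e0' : 0 < complex.Re e * (1 - q) by rewrite mulr_gt0// -ltcR -eE.
  have [N hN] := geometric_lt c q0 q1 e0'.
  exists (u N); exists N => // m /= Nm.
  rewrite -ball_normE /ball_ /= rnormE eE ltcR rnormB -(subnKC Nm).
  by rewrite (le_lt_trans (hd _ _))// ltr_pdivrMr.
have /cauchy_cvgP /cvg_ex [l hl] := cu.
exists l => n; apply: rnorm_closure => d d0.
move/cvgrPdist_lt: hl => /(_ d%:C); rewrite ltcR => /(_ d0) [N _ hN].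
have := hN (n + N)%N (leq_addl _ _); rewrite /= rnormE ltcR => h.
rewrite -(subrKA (u (n + N)%N)) (le_trans (rnormD _ _))// addrC lerD//; exact: ltW.
Qed.

End RealNorm.

(** * Hom spaces of a 2-C*-category *)

Section FixedPoints.
Context {R : realType}.
Local Notation C := (complex R).
Local Notation "x %:C" := (real_complex R x) : ring_scope.

Lemma geometric_eq0 (V : normedZmodType C) (x : V) (c q : R) :
  0 <= q -> q < 1 -> (forall n, rnorm x <= c * q ^+ n) -> x = 0.
Proof.
move=> q0 q1 h; apply: rnorm0_eq0; apply: rnorm_closure => d d0.
have [n hn] := geometric_lt c q0 q1 d0.
by rewrite add0r (le_trans (h n))// ltW.
Qed.

(** Banach's fixed point theorem on a closed set [D] stable under [f]. It yields both the square
    roots and the Neumann inverses used below. *)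
Lemma contraction_fixpoint (V : completeNormedModType C) (f : V -> V)
    (D : V -> Prop) (x0 : V) (q : R) :
  0 <= q -> q < 1 -> D x0 -> (forall x, D x -> D (f x)) ->
  (forall l, (forall e, 0 < e -> exists2 x, D x & rnorm (l - x) <= e) -> D l) ->
  (forall x y, D x -> D y -> rnorm (f x - f y) <= q * rnorm (x - y)) ->
  exists2 l, D l & f l = l.
Proof.
move=> q0 q1 D0 Df Dc fq; pose u n := iter n f x0.
have Du n : D (u n) by elim: n => //= n; exact: Df.
set c := rnorm (f x0 - x0).
have hu n : rnorm (u n.+1 - u n) <= c * q ^+ n.
  elim: n => [|n IH]; first by rewrite expr0 mulr1.
  apply: le_trans (fq (u n.+1) (u n) (Du _) (Du _)) _.
  by rewrite exprS mulrCA ler_wpM2l.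
have [l hl] := geometric_cvg q0 q1 hu.
have q1' : 0 < 1 - q by rewrite subr_gt0.
have Dl : D l.
  apply: Dc => e e0.
  have e0' : 0 < e * (1 - q) by rewrite mulr_gt0.
  have [n hn] := geometric_lt c q0 q1 e0'.
  by exists (u n); rewrite // (le_trans (hl n))// ler_pdivrMr// ltW.
exists l => //; apply/eqP; rewrite -subr_eq0; apply/eqP.
(* Both [f l - u n.+1] and [u n.+1 - l] are bounded by [c * q ^+ n.+1 / (1 - q)]. *)
apply: (@geometric_eq0 _ _ (2 * c / (1 - q)) q) => // n.
rewrite -(subrKA (u n.+1)) (le_trans (rnormD _ _))//.
have h1 := le_trans (fq _ _ Dl (Du n)) (ler_wpM2l q0 (hl n)).
have h2 := hl n.+1; rewrite rnormB in h2.
rewrite (le_trans (lerD h1 h2))//.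
have cq : 0 <= c * q ^+ n / (1 - q).
  by rewrite mulr_ge0 ?invr_ge0 ?(ltW q1')// mulr_ge0 ?exprn_ge0// rnorm_ge0.
rewrite (_ : _ + _ = 2 * (q * (c * q ^+ n / (1 - q)))); last by rewrite exprS; ring.
rewrite (_ : 2 * c / (1 - q) * q ^+ n = 2 * (c * q ^+ n / (1 - q))); last by ring.
by rewrite ler_pM2l// ler_piMl// ltW.
Qed.

Lemma linear_add (U V : lmodType C) (f : U -> V) : linear f ->
  {morph f : x y / x + y}.
Proof. by move=> h x y; rewrite -{1}(scale1r x) h scale1r. Qed.

Lemma linear_zero (U V : lmodType C) (f : U -> V) : linear f -> f 0 = 0.
Proof. by move=> h; apply: (addrI (f 0)); rewrite -(linear_add h) !addr0. Qed.

Lemma linear_scale (U V : lmodType C) (f : U -> V) : linear f ->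
  forall a, {morph f : x / a *: x}.
Proof. by move=> h a x; rewrite -{1}(addr0 (a *: x)) h (linear_zero h) addr0. Qed.

Lemma linear_opp (U V : lmodType C) (f : U -> V) : linear f ->
  {morph f : x / - x}.
Proof. by move=> h x; rewrite -scaleN1r (linear_scale h) scaleN1r. Qed.

End FixedPoints.

(** * Calculus of 2-arrows: bilinearity, involution, norms, square roots *)

Section TwoCstar.
Context {R : realType} {CC : twoCstarCategory R}.
Local Notation C := (complex R).
Local Notation "x %:C" := (real_complex R x) : ring_scope.

Section Hom.
Context {A B : obj CC}.
Implicit Types (r s t : arr1 CC A B).

Lemma vcompDl r s t (S1 S2 : arr2 s t) (T : arr2 r s) :
  vcomp (S1 + S2) T = vcomp S1 T + vcomp S2 T.
Proof. exact: (linear_add (vcomp_linearl T)). Qed.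

Lemma vcompDr r s t (S : arr2 s t) (T1 T2 : arr2 r s) :
  vcomp S (T1 + T2) = vcomp S T1 + vcomp S T2.
Proof. exact: (linear_add (vcomp_linearr S)). Qed.

Lemma vcompZl r s t a (S : arr2 s t) (T : arr2 r s) :
  vcomp (a *: S) T = a *: vcomp S T.
Proof. exact: (linear_scale (vcomp_linearl T)). Qed.

Lemma vcompZr r s t a (S : arr2 s t) (T : arr2 r s) :
  vcomp S (a *: T) = a *: vcomp S T.
Proof. exact: (linear_scale (vcomp_linearr S)). Qed.

Lemma vcompNl r s t (S : arr2 s t) (T : arr2 r s) : vcomp (- S) T = - vcomp S T.
Proof. exact: (linear_opp (vcomp_linearl T)). Qed.

Lemma vcompNr r s t (S : arr2 s t) (T : arr2 r s) : vcomp S (- T) = - vcomp S T.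
Proof. exact: (linear_opp (vcomp_linearr S)). Qed.

Lemma vcomp0l r s t (T : arr2 r s) : vcomp (0 : arr2 s t) T = 0.
Proof. exact: (linear_zero (vcomp_linearl T)). Qed.

Lemma vcomp0r r s t (S : arr2 s t) : vcomp S (0 : arr2 r s) = 0.
Proof. exact: (linear_zero (vcomp_linearr S)). Qed.

Lemma vcompBl r s t (S1 S2 : arr2 s t) (T : arr2 r s) :
  vcomp (S1 - S2) T = vcomp S1 T - vcomp S2 T.
Proof. by rewrite vcompDl vcompNl. Qed.

Lemma vcompBr r s t (S : arr2 s t) (T1 T2 : arr2 r s) :
  vcomp S (T1 - T2) = vcomp S T1 - vcomp S T2.
Proof. by rewrite vcompDr vcompNr. Qed.

Lemma starD r s (S T : arr2 r s) : star (S + T) = star S + star T.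
Proof. by rewrite -{1}(scale1r S) star_antilinear conjC1 scale1r. Qed.

Lemma star0 r s : star (0 : arr2 r s) = 0.
Proof. by apply: (addrI (star 0)); rewrite -starD !addr0. Qed.

Lemma starZ r s a (S : arr2 r s) : star (a *: S) = Num.conj a *: star S.
Proof. by rewrite -{1}(addr0 (a *: S)) star_antilinear star0 addr0. Qed.

Lemma starZr r s (a : R) (S : arr2 r s) : star (a%:C *: S) = a%:C *: star S.
Proof. by rewrite starZ conj_Creal// complex_real. Qed.

Lemma starN r s (S : arr2 r s) : star (- S) = - star S.
Proof. by rewrite -scaleN1r starZ rmorphN rmorph1 scaleN1r. Qed.

Lemma starB r s (S T : arr2 r s) : star (S - T) = star S - star T.
Proof. by rewrite starD starN. Qed.

Lemma star_id r : star (id2 r) = id2 r.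
Proof. by rewrite -[LHS]vcomp1l -{1}(starK (id2 r)) -star_vcomp vcomp1l starK. Qed.

Lemma rnorm_vcomp r s t (S : arr2 s t) (T : arr2 r s) :
  rnorm (vcomp S T) <= rnorm S * rnorm T.
Proof. by rewrite -lecR rmorphM/= -!rnormE norm_vcomp. Qed.

Lemma rnorm_star_vcomp r s (S : arr2 r s) :
  rnorm (vcomp (star S) S) = rnorm S ^+ 2.
Proof. by apply: complexI; rewrite rmorphXn/= -!rnormE norm_star_vcomp. Qed.

(** The C*-identity and submultiplicativity give |T|^2 <= |T^*| |T|; divide by |T| and apply this to
    T^* as well. *)
Lemma rnorm_star r s (S : arr2 r s) : rnorm (star S) = rnorm S.
Proof.
have le s' t (T : arr2 s' t) : rnorm T <= rnorm (star T).
  have [/rnorm_eq0 ->|] := eqVneq (rnorm T) 0; first by rewrite star0 !rnorm0.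
  move=> T0; have T0' : 0 < rnorm T by rewrite lt_def T0 rnorm_ge0.
  by rewrite -(ler_pM2r T0') -expr2 -rnorm_star_vcomp rnorm_vcomp.
by apply: le_anti; rewrite le andbT (le_trans (le _ _ _))// starK.
Qed.

(** The norm n satisfies n = n^2. Equality with 1 can fail, since [id2 r] may be 0. *)
Lemma rnorm_id r : rnorm (id2 r) <= 1.
Proof.
have := rnorm_star_vcomp (id2 r); rewrite star_id vcomp1l => h.
have [->|n0] := eqVneq (rnorm (id2 r)) 0; first exact: ler01.
by move/eqP: h; rewrite expr2 -{1}(mulr1 (rnorm _)) (inj_eq (mulfI n0)) => /eqP <-.
Qed.

(** The root is 1 - l, where l is the fixed point of y -> (h + y^2) / 2 among self-adjoint y of norm
    at most 1/2. The bound 3/4 makes this ball stable: (3/4 + 1/4) / 2 = 1/2. *)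
Lemma exists_sqrt_id_sub r (h : arr2 r r) : star h = h -> rnorm h <= 3 / 4 ->
  exists2 k : arr2 r r, star k = k & vcomp k k = id2 r - h.
Proof.
move=> hs hn.
pose f (y : arr2 r r) := (2^-1 : R)%:C *: (h + vcomp y y).
pose D (y : arr2 r r) := star y = y /\ rnorm y <= 2^-1.
have half : 0 <= (2^-1 : R) by rewrite invr_ge0.
have fE y : rnorm (f y) = 2^-1 * rnorm (h + vcomp y y).
  by rewrite rnormZ rnorm_real ger0_norm.
have [||||||l [ls ln] lE] := @contraction_fixpoint _ (arr2 r r) f D 0 2^-1.
- exact: half.
- by rewrite invf_lt1// ltr1n.
- by split; rewrite ?star0// rnorm0.
- move=> y [ys yn]; split; first by rewrite starZr starD hs star_vcomp ys.
  rewrite fE (le_trans (ler_wpM2l half (rnormD _ _)))//.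
  have : rnorm y * rnorm y <= 2^-1 * 2^-1 by rewrite ler_pM// rnorm_ge0.
  by move: (rnorm_vcomp y y) => *; lra.
- move=> l hl; split; last first.
    apply: rnorm_closure => d d0; have [x [_ xn] hx] := hl _ d0.
    by rewrite -(subrK x l) addrC (le_trans (rnormD _ _))// lerD.
  apply/eqP; rewrite -subr_eq0; apply/eqP/rnorm0_eq0/rnorm_closure => d d0.
  have [|x [xs _] hx] := hl (d / 2); first by rewrite divr_gt0.
  rewrite add0r -(subrKA x) (le_trans (rnormD _ _))// -{1}xs -starB rnorm_star.
  by rewrite (rnormB x) (le_trans (lerD hx hx))// -splitr.
- move=> x y [_ xn] [_ yn].
  (* Noncommutative factorization x^2 - y^2 = x (x - y) + (x - y) y. *)
  have -> : f x - f y = (2^-1 : R)%:C *: (vcomp x (x - y) + vcomp (x - y) y).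
    by rewrite /f -scalerBr vcompBl vcompBr subrKA opprD addrACA subrr add0r.
  rewrite rnormZ rnorm_real ger0_norm// ler_wpM2l// (le_trans (rnormD _ _))//.
  rewrite (le_trans (lerD (rnorm_vcomp _ _) (rnorm_vcomp _ _)))//.
  have := rnorm_ge0 (x - y) => n0.
  have h1 : rnorm x * rnorm (x - y) <= 2^-1 * rnorm (x - y) by rewrite ler_wpM2r.
  have h2 : rnorm (x - y) * rnorm y <= rnorm (x - y) * 2^-1 by rewrite ler_wpM2l.
  by lra.
exists (id2 r - l); first by rewrite starB star_id ls.
rewrite vcompBl !vcompBr !vcomp1l vcomp1r.
(* The fixed point equation 2 l = h + l^2, so that (1 - l)^2 = 1 - h. *)
have -> : h = l + l - vcomp l l.
  rewrite -{1 2}lE /f -scalerDl -rmorphD/= -[2^-1]mul1r -splitr.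
  by rewrite scale1r addrK.
by rewrite !opprD !opprK !addrA.
Qed.

End Hom.

(** * Sums of squares through direct sums *)

Section DirectSums.
Hypothesis hsum : closed_under_direct_sums CC.
Context {A B : obj CC}.
Implicit Types (r s t : arr1 CC A B).

(** [V] is the column with entries [S] and [T], a 2-arrow into a direct sum of [s] and [t]; [W] is
    the inclusion of [s]. *)
Lemma star_vcomp_sum r s t (S : arr2 r s) (T : arr2 r t) :
  exists u (V : arr2 r u) (W : arr2 s u),
    [/\ vcomp (star V) V = vcomp (star S) S + vcomp (star T) T,
        S = vcomp (star W) V & rnorm W <= 1].
Proof.
have [u [W1 [W2 [h11 h22 h12 h21 _]]]] := hsum s t.
exists u, (vcomp W1 S + vcomp W2 T), W1; split.
- rewrite starD !star_vcomp vcompDl !vcompDr -!vcompA.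
  rewrite !(vcompA (star W1)) !(vcompA (star W2)) h11 h22 h12 h21.
  by rewrite !vcomp1l !vcomp0l !vcomp0r addr0 add0r.
- by rewrite vcompDr !vcompA h11 h12 vcomp1l vcomp0l addr0.
- rewrite -(@ler_sqr _ (rnorm W1)) ?nnegrE ?rnorm_ge0// expr1n.
  by rewrite -rnorm_star_vcomp h11 rnorm_id.
Qed.

Lemma star_vcomp_add r s t (S : arr2 r s) (T : arr2 r t) :
  exists X : arr2 r r,
    vcomp (star S) S + vcomp (star T) T = vcomp (star X) X.
Proof.
have [u [V [_ [<- _ _]]]] := star_vcomp_sum S T.
exact: star_vcomp_pos.
Qed.

(** Turns an algebraic identity into a norm bound: [S] factors through the column [V], whose norm is
    given by the C*-identity. *)
Lemma rnorm_le_of_sum r s t (S : arr2 r s) (T : arr2 r t) (m : R) :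
  vcomp (star S) S + vcomp (star T) T = m%:C *: id2 r -> rnorm S ^+ 2 <= `|m|.
Proof.
have [u [V [W [<- -> Wn]]]] := star_vcomp_sum S T.
move=> /(congr1 (@rnorm R _)); rewrite rnorm_star_vcomp rnormZ rnorm_real => h.
apply: (@le_trans _ _ (rnorm V ^+ 2)).
  rewrite ler_sqr ?nnegrE ?rnorm_ge0// (le_trans (rnorm_vcomp _ _))//.
  by rewrite rnorm_star ler_piMl ?rnorm_ge0.
by rewrite h ler_piMr// rnorm_id.
Qed.

End DirectSums.

(** * Tensoring with an identity 2-arrow *)

Section Tensor.
Context {A B D : obj CC}.
Implicit Types (r : arr1 CC B D) (s t : arr1 CC A B).

Lemma tens2Dr r s t (S T : arr2 s t) :
  tens2 (id2 r) (S + T) = tens2 (id2 r) S + tens2 (id2 r) T.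
Proof. exact: (linear_add (tens2_linearr (id2 r))). Qed.

Lemma tens2Zr r s t a (S : arr2 s t) :
  tens2 (id2 r) (a *: S) = a *: tens2 (id2 r) S.
Proof. exact: (linear_scale (tens2_linearr (id2 r))). Qed.

Lemma tens20r r s t : tens2 (id2 r) (0 : arr2 s t) = 0.
Proof. exact: (linear_zero (tens2_linearr (id2 r))). Qed.

Lemma tens2_id_vcomp r (s t u : arr1 CC A B) (S : arr2 t u) (T : arr2 s t) :
  tens2 (id2 r) (vcomp S T) = vcomp (tens2 (id2 r) S) (tens2 (id2 r) T).
Proof. by rewrite -tens2_vcomp vcomp1l. Qed.

(* With M = 2|S|^2, write M - S^*S = k^*k and tensor this identity. *)
Lemma rnorm_tens2_id r s t (S : arr2 s t) : closed_under_direct_sums CC ->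
  rnorm (tens2 (id2 r) S) ^+ 2 <= 2 * rnorm S ^+ 2.
Proof.
move=> hsum; have [/rnorm_eq0 ->|S0] := eqVneq (rnorm S) 0.
  by rewrite tens20r !rnorm0 expr0n mulr0.
have m0 : 0 < 2 * rnorm S ^+ 2 by rewrite mulr_gt0// exprn_gt0// lt_def S0 rnorm_ge0.
set m := 2 * _ in m0 *.
have [||k ks kk] := @exists_sqrt_id_sub _ _ s ((m^-1)%:C *: vcomp (star S) S).
- by rewrite starZr star_vcomp starK.
- rewrite rnormZ rnorm_star_vcomp rnorm_real gtr0_norm ?invr_gt0//.
  rewrite /m invfM -mulrA mulVf ?mulr1; first by lra.
  by rewrite sqrf_eq0.
rewrite -[leRHS](gtr0_norm m0).
apply: (@rnorm_le_of_sum hsum _ _ _ _ _ _ (tens2 (id2 r) ((Num.sqrt m)%:C *: k))).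
rewrite !star_tens2 star_id -!tens2_id_vcomp -tens2Dr -tens2_id -tens2Zr.
congr tens2; rewrite starZr ks vcompZl vcompZr scalerA -rmorphM/= -expr2.
rewrite sqr_sqrtr ?(ltW m0)// kk scalerBr scalerA -rmorphM/= mulfV ?gt_eqF//.
by rewrite scale1r addrC subrK.
Qed.

End Tensor.
End TwoCstar.

(** * Transports, and the conjugation equations *)

Section Casts.
Context {R : realType} {CC : twoCstarCategory R}.
Local Notation C := (complex R).

Section Hom.
Context {A B : obj CC}.
Local Notation cast := (hcast (fun x y : arr1 CC A B => arr2 x y)).

(** By proof irrelevance a transport depends only on its endpoints, so coherence between chains of
    associators and units is automatic. *)
Lemma hcast_irr (r r' s s' : arr1 CC A B) (e e' : r = r') (f f' : s = s')
  (S : arr2 r s) : cast e f S = cast e' f' S.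
Proof. by rewrite (Prop_irrelevance e e') (Prop_irrelevance f f'). Qed.

Lemma hcast_refl (r s : arr1 CC A B) (e : r = r) (f : s = s) (S : arr2 r s) :
  cast e f S = S.
Proof. by rewrite (hcast_irr e erefl f erefl). Qed.

Lemma hcast_trans (r r' r'' s s' s'' : arr1 CC A B) (e : r = r') (e' : r' = r'')
  (f : s = s') (f' : s' = s'') (S : arr2 r s) :
  cast e' f' (cast e f S) = cast (etrans e e') (etrans f f') S.
Proof. by case: _ / e' ; case: _ / f'. Qed.

Lemma hcast_vcomp (r r' s s' t t' : arr1 CC A B) (e : r = r') (f : s = s')
  (g : t = t') (S : arr2 s t) (T : arr2 r s) :
  cast e g (vcomp S T) = vcomp (cast f g S) (cast e f T).
Proof. by case: _ / e; case: _ / f; case: _ / g. Qed.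

Lemma rnorm_hcast (r r' s s' : arr1 CC A B) (e : r = r') (f : s = s')
  (S : arr2 r s) : rnorm (cast e f S) = rnorm S.
Proof. by case: _ / e; case: _ / f. Qed.

End Hom.

Local Notation cast := (hcast (fun x y => arr2 x y)).

Lemma tens2_hcastr (A B D : obj CC) (r r' : arr1 CC B D)
    (s s' t t' : arr1 CC A B) (e : s = s') (f : t = t') (S : arr2 r r')
    (T : arr2 s t) :
  tens2 S (cast e f T) = cast (congr1 (tens1 r) e) (congr1 (tens1 r') f) (tens2 S T).
Proof. by case: _ / e; case: _ / f. Qed.

Lemma tens2_unitl (A B : obj CC) (r s : arr1 CC A B) (S : arr2 r s) e f :
  cast e f (tens2 (id2 (unit1 B)) S) = S.
Proof. by rewrite (hcast_irr _ (tens11r r) _ (tens11r s)) tens21l. Qed.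

Lemma tens2_unitr (A B : obj CC) (r s : arr1 CC A B) (S : arr2 r s) e f :
  cast e f (tens2 S (id2 (unit1 A))) = S.
Proof. by rewrite (hcast_irr _ (tens1r1 r) _ (tens1r1 s)) tens21r. Qed.

Lemma tens2_assoc (A B D E : obj CC) (r r' : arr1 CC D E) (s s' : arr1 CC B D)
    (t t' : arr1 CC A B) (S : arr2 r r') (T : arr2 s s') (U : arr2 t t') e f :
  cast e f (tens2 S (tens2 T U)) = tens2 (tens2 S T) U.
Proof. by rewrite (hcast_irr _ (tens1A r s t) _ (tens1A r' s' t')) tens2A. Qed.

(** Interchange law: X (x) a = (X (x) 1) o (1 (x) a), and both factors are units away from X and
    a. *)
Lemma tens2_unit_act (A : obj CC) (t : arr1 CC A A) (X : arr2 (unit1 A) t)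
    (a : arr2 (unit1 A) (unit1 A)) e f :
  cast e f (tens2 X a) = vcomp X a.
Proof.
rewrite -{1}(vcomp1r X) -{1}(vcomp1l a) tens2_vcomp.
by rewrite (hcast_vcomp _ (tens1r1 _)) tens2_unitr tens2_unitl.
Qed.

(* Eckmann-Hilton *)
Lemma unit_vcompC (A : obj CC) (X Y : arr2 (unit1 A) (unit1 A)) :
  vcomp X Y = vcomp Y X.
Proof.
pose e := tens1r1 (unit1 A).
rewrite -{1}(tens2_unitr X e e) -{1}(tens2_unitl Y e e) -hcast_vcomp.
rewrite -tens2_vcomp vcomp1l vcomp1r -{1}(vcomp1l X) -{1}(vcomp1r Y).
by rewrite tens2_vcomp (hcast_vcomp _ e) tens2_unitr tens2_unitl.
Qed.

(** * The transpose X_T and the action of End(iota_A) *)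

Section Module.
Context {A B : obj CC} {r : arr1 CC A B} {rb : arr1 CC B A}.
Variable (Rr : arr2 (unit1 A) (tens1 rb r)).

(** The Frobenius transpose of [T], written X_T in the overview. *)
Definition half_turn (s : arr1 CC A B) (T : arr2 r s) :
  arr2 (unit1 A) (tens1 rb s) := vcomp (tens2 (id2 rb) T) Rr.

Lemma hom_innerE (s : arr1 CC A B) (T S : arr2 r s) :
  hom_inner Rr T S = vcomp (star (half_turn S)) (half_turn T).
Proof.
by rewrite /hom_inner /half_turn star_vcomp star_tens2 star_id tens2_id_vcomp !vcompA.
Qed.

Lemma half_turn_linear (s : arr1 CC A B) : linear (@half_turn s).
Proof.
by move=> a T S; rewrite /half_turn tens2Dr tens2Zr vcompDl vcompZl.
Qed.

Lemma rnorm_half_turn (s : arr1 CC A B) (T : arr2 r s) :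
  closed_under_direct_sums CC ->
  rnorm (half_turn T) <= 2 * rnorm Rr * rnorm T.
Proof.
move=> hsum; apply: (le_trans (rnorm_vcomp _ _)).
rewrite mulrAC ler_wpM2r ?rnorm_ge0//.
(* Squares are compared with 2 <= 2^2, which avoids a factor sqrt 2. *)
rewrite -ler_sqr ?nnegrE ?mulr_ge0 ?rnorm_ge0//.
rewrite (le_trans (rnorm_tens2_id _ _ hsum))// exprMn ler_wpM2r ?sqr_ge0//.
by rewrite expr2 ler_pMl ?ltr0n// ler1n.
Qed.

(** The right action T a = T (x) a, brought back to [Hom(r, s)] by the strict unit laws. *)
Definition hom_act (s : arr1 CC A B) (T : arr2 r s)
    (a : arr2 (unit1 A) (unit1 A)) : arr2 r s :=
  cast (tens1r1 r) (tens1r1 s) (tens2 T a).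

(** Write R as R (x) 1 and reassociate 1 (x) (T (x) a); the interchange law then gives X_T (x) a,
    which is X_T o a. *)
Lemma half_turn_act (s : arr1 CC A B) (T : arr2 r s) a :
  half_turn (hom_act T a) = vcomp (half_turn T) a.
Proof.
rewrite /half_turn /hom_act tens2_hcastr.
have -> : Rr = cast (tens1r1 _) (tens1r1 _) (tens2 Rr (id2 (unit1 A))).
  by rewrite tens2_unitr.
have -> (e : tens1 rb (tens1 r (unit1 A)) = tens1 rb r) f :
    cast e f (tens2 (id2 rb) (tens2 T a)) =
    cast (tens1r1 _) (tens1r1 _) (tens2 (tens2 (id2 rb) T) a).
  rewrite -(tens2_assoc _ _ _ (tens1A _ _ _) (tens1A _ _ _)) hcast_trans.
  exact: hcast_irr.
rewrite -hcast_vcomp -tens2_vcomp vcomp1r tens2_unitr; exact: tens2_unit_act.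
Qed.

(** By interchange [T] slides past [star Rb], and what remains is the first conjugation equation. *)
Lemma half_turnK (Rb : arr2 (unit1 B) (tens1 r rb)) (s : arr1 CC A B)
    (T : arr2 r s) :
  conjugation_equations Rr Rb ->
  T = vcomp (cast (esym (tens1A r rb s)) (tens11r s) (tens2 (star Rb) (id2 s)))
        (cast (tens1r1 r) erefl (tens2 (id2 r) (half_turn T))).
Proof.
case=> conj _; rewrite /half_turn tens2_id_vcomp.
rewrite (hcast_vcomp _ erefl) vcompA.
pose e := tens1A r rb r; pose f := tens1A r rb s.
have -> : tens2 (id2 r) (tens2 (id2 rb) T) =
    cast (esym e) (esym f) (tens2 (id2 (tens1 r rb)) T).
  by rewrite -tens2_id -(tens2_assoc _ _ _ e f) hcast_trans hcast_refl.
rewrite [cast erefl erefl _]/= -hcast_vcomp -tens2_vcomp vcomp1l vcomp1r.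
rewrite -{1}(vcomp1l (star Rb)) -{2}(vcomp1r T) tens2_vcomp.
by rewrite (hcast_vcomp _ (tens11r r)) tens2_unitl -vcompA conj vcomp1r.
Qed.

(** With [rnorm_half_turn] this makes |T| and |X_T| equivalent, so the completeness of [Hom(r, s)]
    can be used through X_T. *)
Lemma rnorm_le_half_turn (Rb : arr2 (unit1 B) (tens1 r rb)) (s : arr1 CC A B) :
  closed_under_direct_sums CC -> conjugation_equations Rr Rb ->
  exists2 K : R, 0 <= K &
    forall T : arr2 r s, rnorm T <= K * rnorm (half_turn T).
Proof.
move=> hsum conj.
exists (rnorm (tens2 (star Rb) (id2 s)) * 2); first by rewrite mulr_ge0 ?rnorm_ge0.
move=> T; rewrite {1}(half_turnK T conj) (le_trans (rnorm_vcomp _ _))//.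
rewrite !rnorm_hcast -mulrA ler_wpM2l ?rnorm_ge0//.
rewrite -ler_sqr ?nnegrE ?mulr_ge0 ?rnorm_ge0//.
rewrite (le_trans (rnorm_tens2_id _ _ hsum))// exprMn ler_wpM2r ?sqr_ge0//.
by rewrite expr2 ler_pMl ?ltr0n// ler1n.
Qed.

End Module.
End Casts.

(** * The positive cone of End(iota_A) *)

(** A separate name for this type, to carry a commutative ring structure whose product is vertical
    composition. *)
Definition End_unit (R : realType) (CC : twoCstarCategory R) (A : obj CC) : Type :=
  arr2 (unit1 A) (unit1 A).

Section EndUnit.
Context {R : realType} {CC : twoCstarCategory R} (A : obj CC).
Local Notation C := (complex R).
Local Notation "x %:C" := (real_complex R x) : ring_scope.
Local Notation E := (End_unit A).

HB.instance Definition _ :=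
  CompleteNormedModule.copy E (@arr2 R CC A A (unit1 A) (unit1 A)).

Fact End_unit_mulDl : left_distributive (vcomp : E -> E -> E) +%R.
Proof. by move=> x y z; exact: vcompDl. Qed.

(** The ring may be trivial: if 1 = 0 in it, there is no character and the spectrum is empty. *)
HB.instance Definition _ := GRing.Zmodule_isComPzRing.Build E
  (fun x y z => vcompA x y z) (@unit_vcompC R CC A)
  (fun x => vcomp1l x) End_unit_mulDl.

Lemma vcomp_mulE (x y : E) : vcomp x y = x * y. Proof. by []. Qed.

Lemma id2_oneE : id2 (unit1 A) = 1 :> E. Proof. by []. Qed.

Definition dag (x : E) : E := star x.

Lemma dagM (x y : E) : dag (x * y) = dag x * dag y.
Proof. by rewrite -[RHS]vcomp_mulE unit_vcompC; exact: star_vcomp. Qed.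

Lemma dag1 : dag 1 = 1. Proof. exact: star_id. Qed.

Lemma dagD (x y : E) : dag (x + y) = dag x + dag y.
Proof. exact: starD. Qed.

Lemma dagN (x : E) : dag (- x) = - dag x.
Proof. exact: starN. Qed.

Lemma dagB (x y : E) : dag (x - y) = dag x - dag y.
Proof. exact: starB. Qed.

Lemma dagK : involutive dag.
Proof. exact: starK. Qed.

Definition scal (c : C) : E := c *: (1 : E).

Fact scal_zmod_morphism : zmod_morphism scal.
Proof. by move=> a b; rewrite /scal scalerBl. Qed.

Fact scal_monoid_morphism : monoid_morphism scal.
Proof.
split=> [|a b]; first exact: scale1r.
rewrite /scal -[RHS]vcomp_mulE vcompZl vcompZr scalerA.
by rewrite vcomp_mulE mulr1.
Qed.

HB.instance Definition _ := GRing.isZmodMorphism.Build C E scal scal_zmod_morphism.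
HB.instance Definition _ := GRing.isMonoidMorphism.Build C E scal scal_monoid_morphism.

Definition rscal : R -> E := scal \o real_complex R.
HB.instance Definition _ := GRing.RMorphism.on rscal.

Lemma scaleE (c : C) (x : E) : c *: x = scal c * x.
Proof. by rewrite -[RHS]vcomp_mulE vcompZl vcomp1l. Qed.

Lemma dag_scal (c : C) : dag (scal c) = scal (Num.conj c).
Proof. by rewrite /scal /dag starZ [star _]dag1. Qed.

Lemma dag_rscal (r : R) : dag (rscal r) = rscal r.
Proof. by rewrite /rscal /= dag_scal conj_Creal// complex_real. Qed.

Lemma rscal_half : rscal 2^-1 + rscal 2^-1 = 1.
Proof. by rewrite -rmorphD/= -(rmorph1 rscal) [in RHS](splitr 1) mul1r. Qed.

Definition herm (x : E) : Prop := dag x = x.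

Definition pos (x : E) : Prop := exists y : E, x = dag y * y.

Lemma herm_rscal r : herm (rscal r). Proof. exact: dag_rscal. Qed.

Lemma hermD x y : herm x -> herm y -> herm (x + y).
Proof. by move=> hx hy; rewrite /herm dagD hx hy. Qed.

Lemma hermN x : herm x -> herm (- x).
Proof. by move=> hx; rewrite /herm dagN hx. Qed.

Lemma hermB x y : herm x -> herm y -> herm (x - y).
Proof. by move=> hx hy; rewrite /herm dagB hx hy. Qed.

Lemma hermM x y : herm x -> herm y -> herm (x * y).
Proof. by move=> hx hy; rewrite /herm dagM hx hy. Qed.

Lemma herm1 : herm 1. Proof. exact: dag1. Qed.

Lemma pos_herm x : pos x -> herm x.
Proof. by case=> y ->; rewrite /herm dagM dagK mulrC. Qed.

Lemma posM x y : pos x -> pos y -> pos (x * y).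
Proof. by case=> u -> [v ->]; exists (u * v); rewrite dagM; ring. Qed.

Lemma pos_sqr x : herm x -> pos (x * x).
Proof. by move=> hx; exists x; rewrite hx. Qed.

Lemma pos_rscal r : 0 <= r -> pos (rscal r).
Proof.
move=> r0; exists (rscal (Num.sqrt r)).
by rewrite dag_rscal -rmorphM/= -expr2 sqr_sqrtr.
Qed.

(** Archimedean property of the cone: with m this scalar, x / m has norm at most 3/4, so 1 - x / m
    has a self-adjoint square root. The summand 1 keeps m positive when x = 0. *)
Lemma pos_rscal_sub x : herm x -> pos (rscal (2 * rnorm x + 1) - x).
Proof.
move=> hx; set m := 2 * rnorm x + 1.
have m0 : 0 < m by have := rnorm_ge0 x; rewrite /m; lra.
have [||k ks kk] := @exists_sqrt_id_sub _ CC A A _ ((m^-1)%:C *: (x : arr2 _ _)).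
- by rewrite starZr [star _]hx.
- rewrite rnormZ rnorm_real gtr0_norm ?invr_gt0// mulrC ler_pdivrMr//.
  by have := rnorm_ge0 x; rewrite /m; lra.
exists (rscal (Num.sqrt m) * (k : E)); rewrite dagM dag_rscal [dag _]ks.
have -> (s kE : E) : s * kE * (s * kE) = s * s * (kE * kE) by move=> *; ring.
rewrite -[(k : E) * _]/(vcomp k k) kk -rmorphM/= -expr2 sqr_sqrtr ?(ltW m0)//.
rewrite id2_oneE scaleE -[scal _]/(rscal _) mulrBr mulr1 mulrA -rmorphM/=.
by rewrite mulfV ?gt_eqF// rmorph1 mul1r.
Qed.

Hypothesis hsum : closed_under_direct_sums CC.

Lemma posD x y : pos x -> pos y -> pos (x + y).
Proof. by case=> u -> [v ->]; exact: (star_vcomp_add hsum). Qed.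

Lemma pos_rscalW x r s : pos (rscal r - x) -> r <= s -> pos (rscal s - x).
Proof.
move=> px rs; have -> : rscal s - x = rscal r - x + rscal (s - r) by ring.
by apply: posD => //; apply: pos_rscal; rewrite subr_ge0.
Qed.

(* The step r |-> r - 1/k of the proof of the Kadison-Dubois representation
   theorem. *)
Lemma pos_shift (b q : E) (k r : R) : herm b -> pos q -> 0 < k ->
  pos (b * q - 1) -> pos (rscal k - q * q * b) -> pos (rscal (2 * k) - q) ->
  0 <= r -> pos (b + rscal r) -> pos (b + rscal (r - k^-1)).
Proof.
move=> hb pq k0 h1 h2 h3 r0 h4.
have k2 : rscal (k^-1 * k^-1) * rscal (k * k) = 1.
  by rewrite -rmorphM/= mulrACA mulVf ?mulr1 ?rmorph1// gt_eqF.
have kk : rscal k * rscal k^-1 = 1 by rewrite -rmorphM/= mulfV ?rmorph1// gt_eqF.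
(* The four summands are positive by the hypotheses; expanded, they leave k^2 (b + r) - k. *)
have -> : b + rscal (r - k^-1) = rscal (k^-1 * k^-1) * (
    (rscal k - q) * (rscal k - q) * (b + rscal r) + rscal (2 * k) * (b * q - 1) +
    rscal r * q * (rscal (2 * k) - q) + (rscal k - q * q * b)).
  rewrite -[LHS]mul1r -{1}k2 -mulrA; congr (_ * _).
  rewrite rmorphB/= (rmorphM _ k k)/= (_ : rscal (2 * k) = rscal k + rscal k).
    transitivity (rscal k * rscal k * (b + rscal r)
      - rscal k * (rscal k * rscal k^-1)); first by ring.
    by rewrite kk; ring.
  by rewrite -rmorphD/=; congr rscal; ring.
apply: posM; first by apply: pos_rscal; rewrite mulr_ge0// invr_ge0 ltW.
do ![apply: posD => //].
- apply: posM => //; apply: pos_sqr; apply: hermB; [exact: herm_rscal|exact: pos_herm].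
- by apply: posM => //; apply: pos_rscal; rewrite mulr_ge0// ltW.
- by do ![apply: posM => //]; exact: pos_rscal.
Qed.

(** Start from b + m >= 0 with m large and lower the constant by 1/k repeatedly, with a fixed k,
    until it reaches 0. *)
Lemma pos_of_mul_ge1 (b q : E) : herm b -> pos q -> pos (b * q - 1) -> pos b.
Proof.
move=> hb pq h1.
pose k := Num.max (2 * rnorm (q * q * b) + 1) (2 * rnorm q + 1).
have k0 : 0 < k.
  by rewrite lt_max; apply/orP; left; have := rnorm_ge0 (q * q * b); lra.
have h2 : pos (rscal k - q * q * b).
  apply: (pos_rscalW (r := 2 * rnorm (q * q * b) + 1)); last by rewrite le_max lexx.
  by apply: pos_rscal_sub; do ![apply: hermM => //]; exact: pos_herm.
have h3 : pos (rscal (2 * k) - q).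
  apply: (pos_rscalW (r := 2 * rnorm q + 1)).
    by apply: pos_rscal_sub; exact: pos_herm.
  have : 2 * rnorm q + 1 <= k by rewrite le_max lexx orbT.
  by lra.
pose m := 2 * rnorm (- b) + 1.
(* Truncation at 0 keeps the constant nonnegative, as [pos_shift] requires. *)
have h n : pos (b + rscal (Num.max 0 (m - n%:R / k))).
  elim: n => [|n IH].
    rewrite mul0r subr0 (_ : Num.max 0 m = m).
      by have := pos_rscal_sub (hermN hb); rewrite opprK addrC.
    by apply/max_idPr; rewrite /m; have := rnorm_ge0 (- b); lra.
  set r := Num.max 0 (m - n%:R / k) in IH.
  have r0 : 0 <= r by rewrite le_max lexx.
  have := pos_shift hb pq k0 h1 h2 h3 r0 IH.
  set r' := Num.max _ _ => p; have rr' : r - k^-1 <= r'.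
    rewrite /r addr_maxl ge_max; apply/andP; split.
      by rewrite le_max sub0r oppr_le0 invr_ge0 (ltW k0).
    rewrite le_max; apply/orP; right.
    by rewrite -natr1 mulrDl mul1r opprD addrA.
  rewrite (_ : b + rscal r' = b + rscal (r - k^-1) + rscal (r' - (r - k^-1))).
    by apply: posD => //; apply: pos_rscal; rewrite subr_ge0.
  by ring.
have mk : m * k < (Num.truncn (m * k)).+1%:R by exact: truncnS_gt.
have := h (Num.truncn (m * k)).+1; rewrite (_ : Num.max _ _ = 0) ?rmorph0 ?addr0//.
by apply/max_idPl; rewrite subr_le0 ler_pdivlMr// ltW.
Qed.

End EndUnit.

(** * Maximal preorderings and characters *)

Section Preordering.
Context {R : realType} {CC : twoCstarCategory R} {A : obj CC}.
Hypothesis hsum : closed_under_direct_sums CC.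
Local Notation C := (complex R).
Local Notation "x %:C" := (real_complex R x) : ring_scope.
Local Notation E := (End_unit A).
Local Notation rscal := (@rscal R CC A).
Local Notation scal := (@scal R CC A).

Record preordering (Q : set E) : Prop := Preordering {
  preord_herm : forall x, Q x -> herm x;
  preord_pos : forall x, pos x -> Q x;
  preordD : forall x y, Q x -> Q y -> Q (x + y);
  preordM : forall x y, Q x -> Q y -> Q (x * y);
  preordN1 : ~ Q (- 1) }.

(** The preordering is P - b P, with P the cone [pos]. If it contained -1 = x - b y, then b y - 1 =
    x would be positive, and so would b. *)
Lemma preordering_not_pos (b : E) : herm b -> ~ pos b ->
  exists2 Q, preordering Q & Q (- b).
Proof.
move=> hb nb; exists [set z | exists x y, [/\ pos x, pos y & z = x - b * y]].
  split.
  - move=> _ [x [y [px py ->]]]; apply: hermB; first exact: pos_herm.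
    by apply: hermM => //; exact: pos_herm.
  - move=> x px; exists x, 0; split=> //; last by ring.
    by rewrite -(rmorph0 rscal); exact: pos_rscal.
  - move=> _ _ [x [y [px py ->]]] [x' [y' [px' py' ->]]].
    exists (x + x'), (y + y'); split; [exact: posD|exact: posD|by ring].
  - move=> _ _ [x [y [px py ->]]] [x' [y' [px' py' ->]]].
    exists (x * x' + b * b * (y * y')), (x * y' + y * x'); split; last by ring.
    + apply: posD => //; first exact: posM.
      by apply: posM; [exact: pos_sqr|exact: posM].
    + by apply: posD => //; exact: posM.
  - move=> [x [y [px py h]]]; apply: nb; apply: (pos_of_mul_ge1 hsum hb py).
    rewrite (_ : b * y - 1 = x) //.
    by rewrite -[x](subrK (b * y)) -h; ring.
exists 0, 1; split; last by ring.
- by rewrite -(rmorph0 rscal); exact: pos_rscal.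
- by rewrite -(rmorph1 rscal); exact: pos_rscal.
Qed.

Lemma preordering_max (Q0 : set E) : preordering Q0 ->
  exists Q, [/\ preordering Q, Q0 `<=` Q &
    forall Q', preordering Q' -> Q `<=` Q' -> Q' `<=` Q].
Proof.
move=> pQ0.
(* set0 is admitted because it is the union of the empty chain *)
pose P := [set Q : set E | Q = set0 \/ (preordering Q /\ Q0 `<=` Q)].
have [F FP Ftot|Q [PQ Qmax]] := @Zorn_bigcup E P.
  have [[X0 FX0 [x0 X0x0]]|h] := pselect (exists2 X, F X & X !=set0); last first.
    left; apply/seteqP; split=> // x [X FX Xx].
    by exfalso; apply: h; exists X => //; exists x.
  have FX X : F X -> X !=set0 -> preordering X /\ Q0 `<=` X.
    by move=> /FP [->|//] [x []].
  have [pX0 QX0] := FX _ FX0 (ex_intro _ _ X0x0).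
  right; split; last by move=> x Qx; exists X0 => //; exact: QX0.
  have two x y : (\bigcup_(X in F) X) x -> (\bigcup_(X in F) X) y ->
      exists X, [/\ F X, preordering X, X x & X y].
    move=> [X FX' Xx] [Y FY Yy]; have [XY|YX] := Ftot _ _ FX' FY.
      by exists Y; split=> //; [apply: (FX _ FY _).1; exists y|exact: XY].
    by exists X; split=> //; [apply: (FX _ FX' _).1; exists x|exact: YX].
  split.
  - move=> x [X FX' Xx]; apply: (preord_herm (FX _ FX' _).1 Xx).
    by exists x.
  - by move=> x px; exists X0 => //; exact: (preord_pos pX0).
  - move=> x y hx hy; have [X [FX' pX Xx Xy]] := two _ _ hx hy.
    by exists X => //; exact: (preordD pX).
  - move=> x y hx hy; have [X [FX' pX Xx Xy]] := two _ _ hx hy.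
    by exists X => //; exact: (preordM pX).
  - move=> [X FX' X1]; apply: (preordN1 (FX _ FX' _).1 X1).
    by exists (- 1).
have Q00 : Q0 0 by apply: (preord_pos pQ0); rewrite -(rmorph0 rscal); exact: pos_rscal.
case: PQ => [Q0E|[pQ Q0Q]].
  exfalso; apply: (Qmax Q0); last by right; split.
  by rewrite Q0E; split=> // /(_ _ Q00).
exists Q; split=> // Q' pQ' QQ'; apply: contrapT => h.
by apply: (Qmax Q'); [split|right; split=> //; exact: subset_trans QQ'].
Qed.

Section Maximal.
Variable Q : set E.
Hypothesis pQ : preordering Q.
Hypothesis Qmax : forall Q', preordering Q' -> Q `<=` Q' -> Q' `<=` Q.

Lemma preord_rscal r : 0 <= r -> Q (rscal r).
Proof. by move=> r0; apply: (preord_pos pQ); exact: pos_rscal. Qed.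

Lemma preord_rscal_lt0 r : r < 0 -> ~ Q (rscal r).
Proof.
move=> r0 h; apply: (preordN1 pQ).
have -> : -1 = rscal (- r^-1) * rscal r.
  by rewrite -rmorphM/= mulNr mulVf ?lt_eqF// rmorphN rmorph1.
by apply: (preordM pQ) => //; apply: preord_rscal; rewrite oppr_ge0 invr_le0 ltW.
Qed.

(** Otherwise Q + c Q would be a preordering containing Q and c, against maximality. *)
Lemma preord_adjoin c : herm c -> ~ Q c ->
  exists q p, [/\ Q q, Q p & -1 = q + c * p].
Proof.
move=> hc nc; apply: contrapT => h; apply: nc.
have Q0 : Q 0 by rewrite -(rmorph0 rscal); exact: preord_rscal.
have Q1 : Q 1 by rewrite -(rmorph1 rscal); exact: preord_rscal.
apply: (Qmax (Q' := [set z | exists q p, [/\ Q q, Q p & z = q + c * p]])).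
- split.
  + move=> _ [q [p [Qq Qp ->]]]; apply: hermD; first exact: (preord_herm pQ).
    by apply: hermM => //; exact: (preord_herm pQ).
  + move=> x px; exists x, 0; split=> //; last by ring.
    exact: (preord_pos pQ).
  + move=> _ _ [x [y [px py ->]]] [x' [y' [px' py' ->]]].
    by exists (x + x'), (y + y'); split; [exact: (preordD pQ)|exact: (preordD pQ)|ring].
  + move=> _ _ [x [y [px py ->]]] [x' [y' [px' py' ->]]].
    exists (x * x' + c * c * (y * y')), (x * y' + y * x'); split; last by ring.
      apply: (preordD pQ); first exact: (preordM pQ).
      apply: (preordM pQ); last exact: (preordM pQ).
      by apply: (preord_pos pQ); exact: pos_sqr.
    by apply: (preordD pQ); exact: (preordM pQ).
  + by move=> [q [p [Qq Qp e]]]; apply: h; exists q, p.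
- by move=> x Qx; exists x, 0; split=> //; ring.
- by exists 0, 1; split=> //; ring.
Qed.

(** If both fail, then c p1 = -(1 + q1) and c p2 = 1 + q2; multiplying these writes -1 as an element
    of Q. *)
Lemma preord_total c : herm c -> Q c \/ Q (- c).
Proof.
move=> hc; apply: contrapT => h.
have [|q1 [p1 [Qq1 Qp1 e1]]] := preord_adjoin hc; first by move=> ?; apply: h; left.
have [|q2 [p2 [Qq2 Qp2 e2]]] := preord_adjoin (hermN hc).
  by move=> ?; apply: h; right.
apply: (preordN1 pQ).
have h1 : c * p1 = -1 - q1 by rewrite e1; ring.
have h2 : c * p2 = 1 + q2.
  by rewrite -[1]opprK e2; ring.
have -> : -1 = q1 + q2 + q1 * q2 + (c * c) * (p1 * p2).
  by rewrite mulrACA h1 h2; ring.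
do ![apply: (preordD pQ) => //]; first exact: (preordM pQ).
apply: (preordM pQ); last exact: (preordM pQ).
by apply: (preord_pos pQ); exact: pos_sqr.
Qed.

(** The hermitian elements of standard part 0 for the order defined by [Q], the future kernel of the
    character. *)
Definition infinitesimal (x : E) : Prop :=
  herm x /\ forall e, 0 < e -> Q (rscal e + x) /\ Q (rscal e - x).

Lemma infinitesimalD x y :
  infinitesimal x -> infinitesimal y -> infinitesimal (x + y).
Proof.
move=> [hx ix] [hy iy]; split=> [|e e0]; first exact: hermD.
have e2 : 0 < e / 2 by rewrite divr_gt0.
have [x1 x2] := ix _ e2; have [y1 y2] := iy _ e2.
have -> : rscal e = rscal (e / 2) + rscal (e / 2) by rewrite -rmorphD/= -splitr.
split.
  rewrite (_ : _ + _ = (rscal (e / 2) + x) + (rscal (e / 2) + y)); last by ring.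
  exact: (preordD pQ).
rewrite (_ : _ - _ = (rscal (e / 2) - x) + (rscal (e / 2) - y)); last by ring.
exact: (preordD pQ).
Qed.

Lemma infinitesimalM x y : infinitesimal x -> herm y -> infinitesimal (x * y).
Proof.
move=> [hx ix] hy; split=> [|e e0]; first exact: hermM.
pose n := Num.max (2 * rnorm y + 1) (2 * rnorm (- y) + 1).
have n0 : 0 < n.
  by rewrite lt_max; apply/orP; left; have := rnorm_ge0 y; lra.
have ny : Q (rscal n - y).
  apply: (preord_pos pQ).
  apply: (pos_rscalW hsum (r := 2 * rnorm y + 1)); last by rewrite le_max lexx.
  exact: pos_rscal_sub.
have ny' : Q (rscal n + y).
  apply: (preord_pos pQ); rewrite -[y]opprK.
  apply: (pos_rscalW hsum (r := 2 * rnorm (- y) + 1)); last by rewrite le_max lexx orbT.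
  by apply: pos_rscal_sub; exact: hermN.
pose d := e / n.
have [x1 x2] := ix d (divr_gt0 e0 n0).
have half : Q (rscal 2^-1) by apply: preord_rscal; rewrite invr_ge0.
have -> : rscal e = rscal 2^-1 * (rscal d * rscal n + rscal d * rscal n).
  by rewrite -!rmorphM/= -rmorphD/= -rmorphM/= /d; congr rscal; field; rewrite gt_eqF.
have h2 := rscal_half A.
split.
  (* Since |y| <= n in the order of [Q] and d n = e, half of (d + x)(n + y) + (d - x)(n - y) is e +
     x y; the other sign is similar. *)
  rewrite (_ : _ + x * y = rscal 2^-1 *
    ((rscal d + x) * (rscal n + y) + (rscal d - x) * (rscal n - y))).
    by apply: (preordM pQ) => //; apply: (preordD pQ); exact: (preordM pQ).
  by rewrite -[x * y]mul1r -{1}h2; ring.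
rewrite (_ : _ - x * y = rscal 2^-1 *
    ((rscal d - x) * (rscal n + y) + (rscal d + x) * (rscal n - y))).
  by apply: (preordM pQ) => //; apply: (preordD pQ); exact: (preordM pQ).
by rewrite -[x * y]mul1r -{1}h2; ring.
Qed.

Lemma infinitesimal_rscal r : infinitesimal (rscal r) -> r = 0.
Proof.
move=> [_ ir]; case: (ltgtP r 0) => // r0; exfalso.
  have [|h _] := ir (- r / 2); first by rewrite divr_gt0// oppr_gt0.
  by move: h; rewrite -rmorphD/=; apply: preord_rscal_lt0; lra.
have [|_] := ir (r / 2); first by rewrite divr_gt0.
by rewrite -rmorphB/=; apply: preord_rscal_lt0; lra.
Qed.

(** The standard part r is the supremum of the t with b - t in [Q]. It is finite by the archimedean
    property, and totality gives the upper estimate. *)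
Lemma infinitesimal_value b : herm b -> exists r, infinitesimal (b - rscal r).
Proof.
move=> hb; pose S := [set t | Q (b - rscal t)].
have Sle t t' : S t -> t' <= t -> S t'.
  rewrite /S /= => h tt'.
  rewrite (_ : b - _ = b - rscal t + rscal (t - t')); last by ring.
  by apply: (preordD pQ) => //; apply: preord_rscal; rewrite subr_ge0.
have hS : has_sup S.
  split.
    exists (- (2 * rnorm (- b) + 1)); rewrite /S /= rmorphN opprK addrC -{2}[b]opprK.
    by apply: (preord_pos pQ); apply: pos_rscal_sub; exact: hermN.
  exists (2 * rnorm b + 1) => t /= St; rewrite leNgt; apply/negP => tn.
  have : Q (rscal (2 * rnorm b + 1 - t)).
    rewrite (_ : rscal _ = (rscal (2 * rnorm b + 1) - b) + (b - rscal t)); last by ring.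
    apply: (preordD pQ) => //.
    by apply: (preord_pos pQ); exact: pos_rscal_sub.
  by apply: preord_rscal_lt0; rewrite subr_lt0.
exists (sup S); split=> [|e e0].
  by apply: hermB => //; exact: herm_rscal.
split.
  have [t St ht] := sup_adherent e0 hS.
  rewrite (_ : rscal e + _ = b - rscal (sup S - e)); last by ring.
  by apply: (Sle t) => //; exact: ltW.
have nS : ~ S (sup S + e).
  by move=> /(sup_upper_bound hS); rewrite gerDl leNgt e0.
have [|//|h] := preord_total (c := b - rscal (sup S + e)).
  by apply: hermB => //; exact: herm_rscal.
by rewrite (_ : rscal e - _ = - (b - rscal (sup S + e)))//; ring.
Qed.

Definition cinfinitesimal (x : E) : Prop := exists u v,
  [/\ infinitesimal u, infinitesimal v & x = u + scal 'i * v].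

Lemma scal_i2 : scal 'i * scal 'i = -1.
Proof. by rewrite -rmorphM/= -expr2 sqrCi rmorphN1. Qed.

Lemma dag_scal_i : dag (scal 'i) = - scal 'i.
Proof. by rewrite dag_scal conjCi rmorphN. Qed.

Lemma cartesian (x : E) : exists u v, [/\ herm u, herm v & x = u + scal 'i * v].
Proof.
exists (rscal 2^-1 * (x + dag x)), (- rscal 2^-1 * scal 'i * (x - dag x)).
have h2 := rscal_half A.
split.
- by rewrite /herm dagM dag_rscal dagD dagK addrC.
- by rewrite /herm !dagM dagN dag_rscal dagB dagK dag_scal_i; ring.
- transitivity (rscal 2^-1 * (x + dag x)
    - (scal 'i * scal 'i) * rscal 2^-1 * (x - dag x)); last by ring.
  by rewrite scal_i2 -{1}[x]mul1r -{1}h2; ring.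
Qed.

Lemma cartesianC (z : C) : exists a b : R, z = a%:C + 'i * b%:C.
Proof.
have /complex_realP [a ha] := Creal_Re z; have /complex_realP [b hb] := Creal_Im z.
by exists a, b; rewrite -ha -hb -Crect.
Qed.

Lemma cinfinitesimalD x y :
  cinfinitesimal x -> cinfinitesimal y -> cinfinitesimal (x + y).
Proof.
move=> [u [v [iu iv ->]]] [u' [v' [iu' iv' ->]]].
by exists (u + u'), (v + v'); split; [exact: infinitesimalD..|ring].
Qed.

Lemma cinfinitesimalM x y : cinfinitesimal x -> cinfinitesimal (x * y).
Proof.
move=> [u [v [iu iv ->]]]; have [u' [v' [hu' hv' ->]]] := cartesian y.
exists (u * u' + v * (- v')), (u * v' + v * u'); split.
- by apply: infinitesimalD; apply: infinitesimalM => //; exact: hermN.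
- by apply: infinitesimalD; apply: infinitesimalM.
- transitivity (u * u' + (scal 'i * scal 'i) * v * v' + scal 'i * (u * v' + v * u')).
    by ring.
  by rewrite scal_i2; ring.
Qed.

Lemma cinfinitesimal_value x : exists z, cinfinitesimal (x - scal z).
Proof.
have [u [v [hu hv ->]]] := cartesian x.
have [a ia] := infinitesimal_value hu; have [b ib] := infinitesimal_value hv.
exists (a%:C + 'i * b%:C), (u - rscal a), (v - rscal b); split=> //.
by rewrite rmorphD rmorphM/=; ring.
Qed.

(** Applying [dag] to x = u + i v gives x = u - i v, hence x = u. *)
Lemma cinfinitesimal_herm x : herm x -> cinfinitesimal x -> infinitesimal x.
Proof.
move=> hx [u [v [iu iv e]]]; suff -> : x = u by [].
have h2 := rscal_half A.
have e' : x = u - scal 'i * v.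
  by rewrite -hx e dagD dagM dag_scal_i iu.1 iv.1 mulNr.
have : rscal 2^-1 * (x + x) = rscal 2^-1 * (u + u).
  by congr (_ * _); rewrite {1}e e'; ring.
by rewrite !mulrDr -!mulrDl h2 !mul1r.
Qed.

Lemma cinfinitesimal_scal z : cinfinitesimal (scal z) -> z = 0.
Proof.
have [a [b ->]] := cartesianC z; move=> [u [v [iu iv]]].
rewrite rmorphD rmorphM/= -[scal a%:C]/(rscal a) -[scal b%:C]/(rscal b) => e.
have e' : rscal a - scal 'i * rscal b = u - scal 'i * v.
  move/(congr1 (@dag R CC A)): e.
  by rewrite !dagD !dagM dag_scal_i !dag_rscal iu.1 iv.1 !mulNr.
have ha : cinfinitesimal (rscal a).
  exists u, (u * 0); split=> //.
    by apply: infinitesimalM => //; rewrite -(rmorph0 rscal); exact: herm_rscal.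
  have h2 := rscal_half A.
  transitivity (rscal 2^-1 * ((rscal a + scal 'i * rscal b) +
    (rscal a - scal 'i * rscal b))); first by rewrite -{1}[rscal a]mul1r -{1}h2; ring.
  by rewrite e' e -{3}[u]mul1r -{1}h2; ring.
have a0 := infinitesimal_rscal (cinfinitesimal_herm (herm_rscal _ _) ha).
(* As a = 0, multiplication by -i isolates b. *)
have hb : cinfinitesimal (rscal b).
  have := cinfinitesimalM (- scal 'i) (ex_intro _ u (ex_intro _ v (And3 iu iv e))).
  rewrite a0 rmorph0 add0r mulrN mulrAC scal_i2 mulN1r opprK.
  by [].
have b0 := infinitesimal_rscal (cinfinitesimal_herm (herm_rscal _ _) hb).
by rewrite a0 b0 rmorph0 mulr0 addr0.
Qed.

End Maximal.

(** The value of chi at x is the unique z for which x - z is infinitesimal. It is linear and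
    multiplicative because the infinitesimals form an ideal. *)
Lemma exists_character (b : E) : herm b -> ~ pos b ->
  exists (chi : E -> C) (r : R), [/\ is_character chi, r <= 0 & chi b = r%:C].
Proof.
move=> hb nb.
have [Q0 pQ0 Q0b] := preordering_not_pos hb nb.
have [Q [pQ Q0Q Qmax]] := preordering_max pQ0.
have [chi chiP] := choice (cinfinitesimal_value pQ Qmax).
have uniq x z : cinfinitesimal Q (x - scal z) -> chi x = z.
  move=> xz; apply/eqP; rewrite -subr_eq0 -oppr_eq0 opprB; apply/eqP.
  apply: (cinfinitesimal_scal pQ).
  rewrite (_ : scal _ = (x - scal (chi x)) + (x - scal z) * (-1)).
    by apply: cinfinitesimalD => //; exact: cinfinitesimalM.
  by rewrite rmorphB; ring.
have [r ir] := infinitesimal_value pQ Qmax hb.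
exists chi, r; split.
- split; [move=> a; change (forall x y : E, chi (a *: x + y) = a * chi x + chi y)
    |change (forall x y : E, chi (x * y) = chi x * chi y)|].
  + move=> x y; apply: uniq; rewrite scaleE rmorphD rmorphM.
    rewrite (_ : _ - _ = (x - scal (chi x)) * scal a + (y - scal (chi y))); last by ring.
    by apply: cinfinitesimalD => //; exact: cinfinitesimalM.
  + move=> x y; apply: uniq; rewrite rmorphM.
    rewrite (_ : _ - _ = (x - scal (chi x)) * y + (y - scal (chi y)) * scal (chi x)).
      by apply: cinfinitesimalD => //; exact: cinfinitesimalM.
    by ring.
  (* That 0 is infinitesimal is seen by writing it as a multiple of [b - rscal r]. *)
  + apply: uniq; rewrite rmorph1 id2_oneE subrr -(mulr0 (b - rscal r)).
    apply: cinfinitesimalM => //.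
    exists (b - rscal r), ((b - rscal r) * 0); split=> //; last by ring.
    by apply: infinitesimalM => //; rewrite -(rmorph0 rscal); exact: herm_rscal.
- rewrite leNgt; apply/negP => r0.
  (* If r > 0, adding -b to r/2 + (b - r) would put the negative scalar -r/2 in [Q]. *)
  have [h _] := ir.2 (r / 2) (divr_gt0 r0 (ltr0Sn _ 1)).
  have := preordD pQ h (Q0Q _ Q0b).
  rewrite (_ : _ + _ + - b = rscal (- (r / 2))).
    by apply: (preord_rscal_lt0 pQ); rewrite oppr_lt0 divr_gt0.
  rewrite (_ : - (r / 2) = r / 2 - r); first by ring.
  by rewrite {3}[r]splitr; ring.
- apply: uniq; exists (b - rscal r), ((b - rscal r) * 0); split=> //; last first.
    by rewrite /rscal/=; ring.
  by apply: infinitesimalM => //; rewrite -(rmorph0 rscal); exact: herm_rscal.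
Qed.

Lemma pos_of_characters (b : E) : herm b ->
  (forall chi : E -> C, is_character chi -> 0 < chi b) -> pos b.
Proof.
move=> hb h; apply: contrapT => nb.
have [chi [r [ch r0 e]]] := exists_character hb nb.
by have := h _ ch; rewrite e ltcR ltNge r0.
Qed.

End Preordering.

(** * Evaluation of End(iota_A) on its spectrum *)

Section Gelfand.
Context {R : realType} {CC : twoCstarCategory R} {A : obj CC}.
Local Notation C := (complex R).
Local Notation "x %:C" := (real_complex R x) : ring_scope.
Local Notation E := (End_unit A).
Local Notation rscal := (@rscal R CC A).
Local Notation scal := (@scal R CC A).

Lemma rnorm_mul (x y : E) : rnorm (x * y) <= rnorm x * rnorm y.
Proof. exact: rnorm_vcomp. Qed.

Lemma rnorm_scal_mul z (x : E) : rnorm (scal z * x) = rnorm z * rnorm x.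
Proof. by rewrite -scaleE rnormZ. Qed.

Lemma rnorm_dag_mul (x : E) : rnorm (dag x * x) = rnorm x ^+ 2.
Proof. exact: (rnorm_star_vcomp (x : arr2 _ _)). Qed.

(** The inverse is the fixed point of the contraction y -> 1 + h y. *)
Lemma neumann (h : E) : rnorm h < 1 -> exists y, (1 - h) * y = 1.
Proof.
move=> h1.
have [||||||y _ e] := @contraction_fixpoint R E (fun y => 1 + h * y)
  (fun=> True) 0 (rnorm h); rewrite ?rnorm_ge0//.
  move=> x y _ _; rewrite (_ : _ - _ = h * (x - y)); last by ring.
  exact: rnorm_mul.
exists y; rewrite mulrBl mul1r -{1}e; ring.
Qed.

Lemma spectrum_of_character (chi : E -> C) : is_character chi ->
  {w : spectrum A | (fun x => spec_eval x w) = chi}.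
Proof.
by move=> ch; exists (SigSub (mem_set ch) : @characters R CC A).
Qed.

Definition gev (w : spectrum A) (x : E) : C := spec_eval x w.

Lemma gev_character w : is_character (gev w).
Proof. exact: (set_valP (w : @characters R CC A)). Qed.

Fact gev_zmod_morphism w : zmod_morphism (gev w).
Proof.
move=> x y; have [h _ _] := gev_character w.
by rewrite -[x - y]addrC -scaleN1r h mulN1r addrC.
Qed.

Fact gev_monoid_morphism w : monoid_morphism (gev w).
Proof. by have [_ h1 h2] := gev_character w; split=> // x y; exact: h1. Qed.

HB.instance Definition _ w :=
  GRing.isZmodMorphism.Build E C (gev w) (gev_zmod_morphism w).
HB.instance Definition _ w :=
  GRing.isMonoidMorphism.Build E C (gev w) (gev_monoid_morphism w).

Lemma gev_scal w c : gev w (scal c) = c.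
Proof.
have [h _ h1] := gev_character w.
by rewrite /scal -[_ *: _]addr0 h -[1]id2_oneE h1 mulr1 rmorph0 addr0.
Qed.

Lemma gev_rscal w r : gev w (rscal r) = r%:C.
Proof. exact: gev_scal. Qed.

(** With z = [gev w x] of norm larger than |x|, the element 1 - x / z would be invertible and yet
    vanish at w. *)
Lemma rnorm_gev w (x : E) : rnorm (gev w x) <= rnorm x.
Proof.
rewrite leNgt; apply/negP => lt.
have z0 : gev w x != 0.
  by apply/eqP => z0; move: lt; rewrite z0 rnorm0 ltNge rnorm_ge0.
have n0 : 0 < rnorm (gev w x) by rewrite (le_lt_trans (rnorm_ge0 x)).
have [|y /(congr1 (gev w))] := @neumann (scal (gev w x)^-1 * x).
  rewrite rnorm_scal_mul -(ltr_pM2l n0) mulrA -rnormM mulfV// mulr1.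
  by rewrite (_ : rnorm (1 : C) = 1) ?mul1r// -(rmorph1 (real_complex R)) rnorm_real normr1.
rewrite !(rmorphM, rmorphB, rmorph1)/= gev_scal mulVf// subrr mul0r.
by move/eqP; rewrite eq_sym oner_eq0.
Qed.

Lemma conj_imaginary (k : R) : Num.conj (Complex 0 k) = Complex 0 (- k).
Proof. by []. Qed.

(* Arens' trick: |gev (x + i k)|^2 <= |x|^2 + k^2 for every real k. *)
Lemma gev_herm w (x : E) : herm x -> exists r, gev w x = r%:C.
Proof.
move=> hx; case ez: (gev w x) => [s t].
suff -> : t = 0 by exists s.
apply/eqP; apply: contrapT => /negP t0.
(* Chosen so that the cross term 2 t k of (t + k)^2 is |x|^2 + 1, too large for the bound. *)
pose k := (rnorm x ^+ 2 + 1) / (2 * t).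
pose y := x + scal (Complex 0 k).
have h1 : rnorm (gev w y) ^+ 2 = s ^+ 2 + (t + k) ^+ 2.
  have -> : gev w y = Complex s (t + k).
    rewrite /y [gev w _]rmorphD/= gev_scal ez.
    by apply/eqP; rewrite eq_complex /= addr0 !eqxx.
  by apply: complexI; rewrite [LHS]rmorphXn/= -rnormE -add_Re2_Im2.
have h2 : rnorm y ^+ 2 <= rnorm x ^+ 2 + k ^+ 2.
  rewrite -rnorm_dag_mul /y dagD hx dag_scal conj_imaginary.
  rewrite (_ : _ * _ = x * x + rscal (k ^+ 2)).
    rewrite (le_trans (rnormD _ _))// lerD//.
      by rewrite expr2 rnorm_mul.
    rewrite -[rscal _]mulr1 rnorm_scal_mul rnorm_real ger0_norm ?sqr_ge0//.
    by rewrite ler_piMr ?sqr_ge0// rnorm_id.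
  rewrite (_ : scal (Complex 0 (- k)) = - scal (Complex 0 k)).
    rewrite (_ : rscal (k ^+ 2) = - (scal (Complex 0 k) * scal (Complex 0 k))); first by ring.
    rewrite -rmorphM -rmorphN /rscal /=; congr scal.
    by apply/eqP; rewrite eq_complex /=; apply/andP; split; apply/eqP; ring.
  by rewrite -rmorphN; congr scal; apply/eqP; rewrite eq_complex /= oppr0 !eqxx.
have : rnorm (gev w y) ^+ 2 <= rnorm y ^+ 2.
  by rewrite ler_sqr ?nnegrE ?rnorm_ge0// rnorm_gev.
move/le_trans => /(_ _ h2); rewrite h1.
rewrite (_ : (t + k) ^+ 2 = t ^+ 2 + 2 * t * k + k ^+ 2); last by ring.
have -> : 2 * t * k = rnorm x ^+ 2 + 1.
  by rewrite /k; field.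
by have := sqr_ge0 s; have := sqr_ge0 t; lra.
Qed.

Lemma gev_dag w (x : E) : gev w (dag x) = Num.conj (gev w x).
Proof.
have [u [v [hu hv ->]]] := cartesian x.
have [a ha] := gev_herm w hu; have [b hb] := gev_herm w hv.
rewrite dagD dagM dag_scal_i hu hv !(rmorphD, rmorphM, rmorphN)/=.
rewrite gev_scal ha hb conjCi.
by congr (_ + _ * _); rewrite -[LHS]conj_Creal// complex_real.
Qed.

Lemma gev_dag_mul w (x : E) : gev w (dag x * x) = (rnorm (gev w x) ^+ 2)%:C.
Proof. by rewrite rmorphM/= gev_dag rmorphXn/= -rnormE normCKC. Qed.

Lemma gev_pos w (x : E) : pos x -> exists2 r, 0 <= r & gev w x = r%:C.
Proof. by case=> y ->; rewrite gev_dag_mul; eexists; last reflexivity; exact: sqr_ge0. Qed.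

(** * Positivity, norms and inverses read off from characters *)

Section Positivity.
Hypothesis hsum : closed_under_direct_sums CC.

Lemma pos_of_gev (b : E) : herm b -> (forall w, 0 < gev w b) -> pos b.
Proof.
move=> hb h; apply: pos_of_characters => // chi /spectrum_of_character [w <-].
exact: h.
Qed.

(** For d > 0, m + d - x^* x is strictly positive at all characters, hence of the form k^* k, and
    [rnorm_le_of_sum] applies. *)
Lemma rnorm_sqr_le (x : E) (m : R) : 0 <= m ->
  (forall w, rnorm (gev w x) ^+ 2 <= m) -> rnorm x ^+ 2 <= m.
Proof.
move=> m0 h; apply/ler_addgt0Pr => d d0.
have hxx : herm (dag x * x) by apply: pos_herm; exists x.
have [|w|k hk] := @pos_of_gev (rscal (m + d) - dag x * x).
- by apply: hermB => //; exact: herm_rscal.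
- rewrite rmorphB/= gev_rscal gev_dag_mul -rmorphB/= ltcR subr_gt0.
  by rewrite (le_lt_trans (h w))// ltrDl.
rewrite -[leRHS](@ger0_norm _ (m + d)) ?addr_ge0 ?(ltW d0)//.
apply: (rnorm_le_of_sum hsum (S := x : arr2 _ _) (T := k : arr2 _ _)).
rewrite -[LHS]/(dag x * x + dag k * k) -hk addrC subrK.
by rewrite id2_oneE.
Qed.

(** For n large, n - p = k^* k; adding p - c gives |k|^2 <= n - c < n. So p = n (1 - k^* k / n) has
    a Neumann inverse. *)
Lemma pos_invertible (p : E) (c : R) : 0 < c -> pos (p - rscal c) ->
  exists q, p * q = 1.
Proof.
move=> c0 pc.
have hp : herm p.
  by rewrite -(subrK (rscal c) p); apply: hermD; [exact: pos_herm|exact: herm_rscal].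
pose n := 2 * rnorm p + 1 + c.
have n0 : 0 < n by rewrite /n; have := rnorm_ge0 p; lra.
have [k hk] : pos (rscal n - p).
  by apply: (pos_rscalW hsum (pos_rscal_sub hp)); rewrite /n lerDl ltW.
have kn : rnorm k ^+ 2 <= n - c.
  have [k' hk'] := pc.
  rewrite -[leRHS](@ger0_norm _ (n - c)); last by rewrite /n; have := rnorm_ge0 p; lra.
  apply: (rnorm_le_of_sum hsum (S := k : arr2 _ _) (T := k' : arr2 _ _)).
  rewrite -[LHS]/(dag k * k + dag k' * k') -hk -hk' scaleE id2_oneE.
  have e : rscal n - p + (p - rscal c) = rscal (n - c) * 1 by ring.
  exact: e.
have [|y] := @neumann (rscal n^-1 * (dag k * k)).
  rewrite rnorm_scal_mul rnorm_real gtr0_norm ?invr_gt0// rnorm_dag_mul.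
  by rewrite mulrC ltr_pdivrMr// mul1r (le_lt_trans kn)// ltrBlDr ltrDl.
have nn : rscal n^-1 * rscal n = 1 by rewrite -rmorphM/= mulVf ?rmorph1// gt_eqF.
rewrite -hk mulrBr nn subKr => e.
by exists (rscal n^-1 * y); rewrite mulrCA mulrA.
Qed.

End Positivity.
End Gelfand.

(** * Topology of the spectrum *)

Section Spectrum.
Context {R : realType}.
Local Notation C := (complex R).
Local Notation "x %:C" := (real_complex R x) : ring_scope.

(** The limit is the supremum of the r such that r <= f holds on a set of [F]; the ultrafilter
    property gives the upper bound. *)
Lemma ultra_limit_real (T : Type) (F : set_system T) (f : T -> R) (M : R) :
  UltraFilter F -> (forall t, `|f t| <= M) ->
  exists l, forall e, 0 < e -> F [set t | `|f t - l| <= e].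
Proof.
move=> UF fM; pose S := [set r | F [set t | r <= f t]].
have hS : has_sup S.
  split.
    by exists (- M); apply: filterS filterT => t _ /=; move: (fM t); rewrite ler_norml => /andP[].
  exists M => r Sr; have [t /= rt] := filter_ex Sr.
  by rewrite (le_trans rt)// (le_trans (ler_norm _)).
exists (sup S) => e e0.
have [r Sr re] := sup_adherent e0 hS.
have nS : F (~` [set t | sup S + e <= f t]).
  have [h|//] := in_ultra_setVsetC [set t | sup S + e <= f t] UF.
  have := sup_upper_bound hS h; rewrite gerDl leNgt e0 //.
apply: filterS (filterI Sr nS) => t /= [rt /negP].
by rewrite -ltNge => st; rewrite ler_norml; lra.
Qed.

Lemma ultra_limit (T : Type) (F : set_system T) (f : T -> C) (M : R) :
  UltraFilter F -> (forall t, rnorm (f t) <= M) ->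
  exists l, forall e, 0 < e -> F [set t | rnorm (f t - l) <= e].
Proof.
move=> UF fM.
have nE (z : C) : rnorm z ^+ 2 = complex.Re z ^+ 2 + complex.Im z ^+ 2.
  by apply: complexI; rewrite [LHS]rmorphXn/= -rnormE add_Re2_Im2.
have Re_le (z : C) : `|complex.Re z| <= rnorm z.
  rewrite -ler_sqr ?nnegrE ?rnorm_ge0//.
  by rewrite nE real_normK ?num_real// lerDl sqr_ge0.
have Im_le (z : C) : `|complex.Im z| <= rnorm z.
  rewrite -ler_sqr ?nnegrE ?rnorm_ge0//.
  by rewrite nE real_normK ?num_real// lerDr sqr_ge0.
have [a ha] := ultra_limit_real UF (fun t => le_trans (Re_le (f t)) (fM t)).
have [b hb] := ultra_limit_real UF (fun t => le_trans (Im_le (f t)) (fM t)).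
exists (Complex a b) => e e0; have e2 : 0 < e / 2 by rewrite divr_gt0.
apply: filterS (filterI (ha _ e2) (hb _ e2)) => t /= [h1 h2].
rewrite -ler_sqr ?nnegrE ?rnorm_ge0 ?(ltW e0)// nE.
case: (f t) h1 h2 => x y /= h1 h2.
rewrite -(real_normK (num_real (x - a))) -(real_normK (num_real (y - b))).
have h3 : `|x - a| ^+ 2 <= (e / 2) ^+ 2 by rewrite ler_sqr ?nnegrE ?(ltW e2).
have h4 : `|y - b| ^+ 2 <= (e / 2) ^+ 2 by rewrite ler_sqr ?nnegrE ?(ltW e2).
rewrite (le_trans (lerD h3 h4))// (_ : _ + _ = e ^+ 2 / 2); last by field.
by rewrite ler_pdivrMr// ler_peMr ?sqr_ge0// ler1n.
Qed.

Context {CC : twoCstarCategory R} {A : obj CC}.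
Local Notation E := (End_unit A).
Local Notation W := (spectrum A).

Lemma gev_continuous (x : E) : continuous (fun w : W => gev w x : C^o).
Proof.
move=> w; have h := @initial_continuous _ _ (@set_val _ (@characters R CC A)) w.
have /pointwise_cvgP/(_ x) hx := h.
apply: hx; rewrite nbhs_filterE. apply: fmap_filter.
exact: (@nbhs_filter (spectrum A) w).
Qed.

Lemma nbhs_gev (x : E) (v : W) (e : R) : 0 < e ->
  \forall w \near v, rnorm (gev w x - gev v x) < e.
Proof.
move=> e0; have /cvgrPdist_lt /(_ e%:C) := @gev_continuous x v.
rewrite ltcR => /(_ e0); apply: filterS => w /=.
by rewrite rnormE ltcR rnormB.
Qed.

Lemma spectrum_cvg (F : set_system W) (w : W) : Filter F ->
  (forall (x : E) e, 0 < e -> F [set t | rnorm (gev t x - gev w x) <= e]) ->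
  F --> w.
Proof.
move=> FF h.
have hc : (@set_val _ (@characters R CC A)) @ F --> set_val (w : @characters R CC A).
  have FF' := @fmap_filter _ _ (@set_val _ (@characters R CC A)) F FF.
  have hp := pointwise_cvgP (set_val (w : @characters R CC A)) FF'. apply: hp.2 => x.
  suff : (gev t x : C^o) @[t --> F] --> (gev w x : C^o) by [].
  apply/cvgrPdist_le => e e0.
  have eE : e = (complex.Re e)%:C by rewrite RRe_real ?gtr0_real.
  have e0' : 0 < complex.Re e by rewrite -ltcR -eE.
  apply: filterS (h x _ e0') => t /= ht.
  by rewrite [leLHS]rnormE eE lecR rnormB.
move=> B [D [[D' oD' <-] Dw] DB].
apply: filterS DB _; apply: hc; exact: open_nbhs_nbhs.
Qed.

Lemma gev_inj (v w : W) : (forall x : E, gev v x = gev w x) -> v = w.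
Proof. by move=> h; apply: val_inj; apply/funext => x; exact: h. Qed.

Lemma spectrum_hausdorff : hausdorff_space W.
Proof.
move=> v w clvw; apply: gev_inj => x; apply/eqP; rewrite -subr_eq0; apply/eqP.
apply: rnorm0_eq0; apply: rnorm_closure => d d0; rewrite add0r.
have d2 : 0 < d / 2 by rewrite divr_gt0.
have [t [/= h1 h2]] := clvw _ _ (nbhs_gev x v d2) (nbhs_gev x w d2).
rewrite -(subrKA (gev t x)) (le_trans (rnormD _ _))// rnormB.
by rewrite (le_trans (lerD (ltW h1) (ltW h2)))// -splitr.
Qed.

(** Banach-Alaoglu by ultrafilters: the pointwise limit chi exists since |w(x)| <= |x|, and the
    identities defining characters pass to the limit. *)
Lemma spectrum_compact : compact [set: W].
Proof.
rewrite compact_ultra => F UF _.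
have [chi chiP] := choice (fun x : E => ultra_limit UF (fun t => rnorm_gev t x)).
have chi0 (z : C) K : 0 <= K ->
    (forall e, 0 < e -> exists t : W, rnorm z <= K * e) -> z = 0.
  move=> K0 h; apply: rnorm0_eq0; apply: rnorm_closure => d d0.
  have K1 : 0 < K + 1 by rewrite ltr_wpDl.
  have [_ hz] := h (d / (K + 1)) (divr_gt0 d0 K1).
  rewrite add0r (le_trans hz)// mulrA ler_pdivrMr// mulrC ler_wpM2l ?(ltW d0)//.
  by rewrite lerDl.
have ch : is_character chi.
  split.
  - move=> a; change (forall x y : E, chi (a *: x + y) = a * chi x + chi y) => x y.
    apply/eqP; rewrite -subr_eq0; apply/eqP.
    apply: (@chi0 _ (1 + rnorm a + 1)); first by rewrite !addr_ge0// rnorm_ge0.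
    move=> e e0.
    have [t [[/= h1 h2] h3]] := filter_ex (filterI (filterI (chiP x _ e0) (chiP y _ e0))
      (chiP (a *: x + y) _ e0)).
    exists t; rewrite (_ : _ - _ = (chi (a *: x + y) - gev t (a *: x + y)) +
      a * (gev t x - chi x) + (gev t y - chi y)); last first.
      by rewrite scaleE !(rmorphD, rmorphM)/= gev_scal; ring.
    do 2!rewrite (le_trans (rnormD _ _))// mulrDl ?lerD ?mul1r//.
      by rewrite rnormB.
    by rewrite rnormM ler_wpM2l ?rnorm_ge0.
  - change (forall x y : E, chi (x * y) = chi x * chi y) => x y.
    apply/eqP; rewrite -subr_eq0; apply/eqP.
    apply: (@chi0 _ (1 + rnorm y + rnorm (chi x))); first by rewrite !addr_ge0// rnorm_ge0.
    move=> e e0.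
    have [t [[/= h1 h2] h3]] := filter_ex (filterI (filterI (chiP x _ e0) (chiP y _ e0))
      (chiP (x * y) _ e0)).
    exists t; rewrite (_ : _ - _ = (chi (x * y) - gev t (x * y)) +
      gev t y * (gev t x - chi x) + chi x * (gev t y - chi y)); last first.
      by rewrite rmorphM/=; ring.
    rewrite (le_trans (rnormD _ _))// mulrDl lerD//; last first.
      by rewrite rnormM ler_wpM2l ?rnorm_ge0.
    rewrite (le_trans (rnormD _ _))// mulrDl lerD ?mul1r//.
      by rewrite rnormB.
    by rewrite rnormM ler_pM ?rnorm_ge0// rnorm_gev.
  - rewrite id2_oneE; apply/eqP; rewrite -subr_eq0; apply/eqP.
    apply: (@chi0 _ 1) => // e e0; have [t /=] := filter_ex (chiP 1 _ e0).
    by exists t; rewrite mul1r rnormB -(rmorph1 (gev t)).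
have [w hw] := spectrum_of_character ch.
exists w; split=> //; apply: spectrum_cvg => x e e0.
have -> : gev w x = chi x by rewrite -hw.
exact: chiP.
Qed.

(** Finite subcovers from the near-covering form of compactness, applied to the filter of all
    sufficiently large finite lists. *)
Lemma spectrum_cover (V : W -> set W) : (forall v, nbhs v (V v)) ->
  exists s : seq W, forall w, exists2 v, v \in s & V v w.
Proof.
move=> hV; pose F : set_system (seq W) :=
  filter_from setT (fun s0 : seq W => [set s : seq W | {subset s0 <= s}]).
have FF : Filter F.
  apply: filter_from_filter; first by exists [::].
  move=> s1 s2 _ _; exists (s1 ++ s2) => // s hs.
  by split=> v vs; apply: hs; rewrite mem_cat vs ?orbT.
have /compact_near_coveringP hc : compact [set: W] by exact: spectrum_compact.
have [x _|s _ /(_ s)] := hc _ F (fun s w => exists2 v, v \in s & V v w) FF.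
  exists (V x, [set s : seq W | x \in s]) => /=.
    by split; [exact: hV|exists [:: x] => // s; apply; rewrite mem_head].
  by move=> [x' s] /= [h1 h2]; exists x.
by move=> h; exists s => w; exact: h.
Qed.

End Spectrum.

(** * Bump functions in End(iota_A) *)

Section Bump.
Context {R : realType} {CC : twoCstarCategory R} {A : obj CC}.
Hypothesis hsum : closed_under_direct_sums CC.
Local Notation C := (complex R).
Local Notation "x %:C" := (real_complex R x) : ring_scope.
Local Notation E := (End_unit A).
Local Notation W := (spectrum A).
Local Notation rscal := (@rscal R CC A).
Local Notation scal := (@scal R CC A).

Lemma pos_sum (I : Type) (s : seq I) (F : I -> E) :
  (forall i, pos (F i)) -> pos (\sum_(i <- s) F i).
Proof.
move=> pF; elim: s => [|i s IH].
  by rewrite big_nil -(rmorph0 rscal); exact: pos_rscal.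
by rewrite big_cons; exact: posD.
Qed.

Lemma herm_inv (p q : E) : herm p -> p * q = 1 -> herm q.
Proof.
move=> hp pq; have qp : dag q * p = 1 by rewrite -hp -dagM mulrC pq dag1.
by rewrite /herm -[LHS]mulr1 -pq mulrA qp mul1r.
Qed.

Lemma herm_exp (x : E) n : herm x -> herm (x ^+ n).
Proof.
move=> hx; elim: n => [|n IH]; first exact: herm1.
by rewrite exprS; exact: hermM.
Qed.

Lemma herm_sum (I : Type) (s : seq I) (F : I -> E) :
  (forall i, herm (F i)) -> herm (\sum_(i <- s) F i).
Proof.
move=> hF; elim: s => [|i s IH].
  by rewrite big_nil -(rmorph0 rscal); exact: herm_rscal.
by rewrite big_cons; exact: hermD.
Qed.

Lemma separating_pos (v : W) (U : set W) : nbhs v U -> forall w : W,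
  exists gN : E * set W, [/\ pos gN.1, gev v gN.1 = 0, nbhs w gN.2 &
    forall t, gN.2 t -> U t \/ 1 <= gev t gN.1].
Proof.
move=> vU w; have [wU|nU] := pselect (nbhs w U).
  exists (0, U); split=> //=; rewrite ?rmorph0//; last by move=> t; left.
  by rewrite -(rmorph0 rscal); exact: pos_rscal.
have [x hx] : exists x : E, gev w x != gev v x.
  apply: contrapT => h; apply: nU; suff -> : w = v by [].
  apply: gev_inj => x; apply: contrapT => /eqP hx; apply: h.
  by exists x.
pose d := rnorm (gev w x - gev v x).
have d0 : 0 < d.
  rewrite lt_def rnorm_ge0 andbT; apply: contra hx => /eqP/rnorm_eq0/eqP.
  by rewrite subr_eq0.
pose y := x - scal (gev v x).
(* On this neighbourhood |y| >= d/2, so the factor 4 / d^2 raises |y|^2 to at least 1. *)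
exists (rscal (4 / d ^+ 2) * (dag y * y), [set t | rnorm (gev t x - gev w x) < d / 2]).
split=> /=.
- apply: posM; last by exists y.
  by apply: pos_rscal; rewrite divr_ge0// sqr_ge0.
- by rewrite !(rmorphM, rmorphB)/= gev_scal subrr !mulr0.
- by apply: nbhs_gev; rewrite divr_gt0.
- move=> t ht; right.
  rewrite rmorphM/= gev_dag_mul gev_rscal -rmorphM/= -(rmorph1 (real_complex R)) lecR.
  have ty : d / 2 <= rnorm (gev t y).
    rewrite /y rmorphB/= gev_scal.
    have : d <= rnorm (gev w x - gev t x) + rnorm (gev t x - gev v x).
      by rewrite /d -(subrKA (gev t x)) rnormD.
    by rewrite rnormB; lra.
  have e1 : 4 / d ^+ 2 * (d / 2) ^+ 2 = 1 by field; rewrite gt_eqF.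
  rewrite -[leLHS]e1.
  rewrite ler_wpM2l ?divr_ge0 ?sqr_ge0//.
  by rewrite ler_sqr ?nnegrE ?rnorm_ge0// divr_ge0 ?(ltW d0).
Qed.

(** Take u = 1 / (1 + f), with f a finite sum of separating elements: f vanishes at v and is at
    least 1 off [U], where therefore u <= 1/2. *)
Lemma spectrum_bump (v : W) (U : set W) : nbhs v U -> exists u : E, [/\ herm u, gev v u = 1 &
  forall t, exists r, [/\ 0 <= r, r <= 1, gev t u = r%:C & 2^-1 < r -> U t]].
Proof.
move=> vU; have [gN hgN] := choice (separating_pos vU).
have [w|s hs] := @spectrum_cover _ _ _ (fun w => (gN w).2); first by have [] := hgN w.
pose f := \sum_(w <- s) (gN w).1.
have pg w : pos (gN w).1 by have [] := hgN w.
have pf : pos f by exact: pos_sum.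
have [||u fu] := @pos_invertible _ _ _ hsum (1 + f) 1; first exact: ltr01.
  by rewrite rmorph1 addrC addKr.
have gu t r : gev t f = r%:C -> 0 <= r -> gev t u = ((1 + r)^-1)%:C.
  move=> fr r0; have r1 : 1 + r != 0 by rewrite gt_eqF// ltr_pwDl.
  move/(congr1 (gev t)): fu; rewrite rmorphM rmorphD !rmorph1/= fr => e.
  have r1' : (1 + r)%:C != 0 by rewrite -(rmorph0 (real_complex R)) (inj_eq (@complexI R)).
  apply: (mulfI r1'); rewrite -[RHS]rmorphM mulfV// rmorph1 -e.
  by rewrite rmorphD rmorph1.
exists u; split.
- by apply: (herm_inv _ fu); apply: hermD; [exact: herm1|exact: pos_herm].
- have -> : gev v u = ((1 + 0)^-1)%:C.
    apply: gu => //; rewrite rmorph0 rmorph_sum/= big1// => w _.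
    by have [] := hgN w.
  by rewrite addr0 invr1 rmorph1.
- move=> t; have [r r0 hr] := gev_pos t pf.
have r1 : 0 < 1 + r by rewrite ltr_pwDl.
exists (1 + r)^-1; split.
- by rewrite invr_ge0 addr_ge0.
- by rewrite invf_cp1 ?lerDl.
- exact: gu.
- rewrite ltf_pV2 ?posrE// => r2.
  have [w ws wt] := hs t; have [_ _ _ /(_ _ wt)] := hgN w.
  case=> // gt; exfalso.
  have [r' r'0 hr'] := gev_pos t (pos_sum (rem w s) pg).
  have fE : f = (gN w).1 + \sum_(i <- rem w s) (gN i).1.
    by rewrite /f (perm_big _ (perm_to_rem ws)) big_cons.
  have : 1 <= r.
    rewrite -lecR rmorph1 -hr fE rmorphD/= hr' (le_trans gt)// lerDl.
    by rewrite -(rmorph0 (real_complex R)) lecR.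
  by lra.
Qed.

End Bump.

(** * Completion of a semi-inner product space *)

Record semiInner (R : realType) (V : lmodType (complex R)) := SemiInner {
  sform :> V -> V -> complex R;
  sform_linear : forall a x y z, sform (a *: x + y) z = a * sform x z + sform y z;
  sform_conj : forall x y, sform y x = Num.conj (sform x y);
  sform_ge0 : forall x, 0 <= sform x x }.

Section SemiInner.
Context {R : realType} {V : lmodType (complex R)} (B : semiInner V).
Local Notation C := (complex R).
Local Notation "x %:C" := (real_complex R x) : ring_scope.

Definition snorm (x : V) : R := Num.sqrt (complex.Re (B x x)).

Lemma snorm_ge0 x : 0 <= snorm x. Proof. exact: sqrtr_ge0. Qed.

Lemma snorm_sqr x : (snorm x ^+ 2)%:C = B x x.
Proof.
have h := sform_ge0 B x.
have e : B x x = (complex.Re (B x x))%:C by rewrite RRe_real ?ger0_real.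
by rewrite /snorm sqr_sqrtr -?e// -lecR -e.
Qed.

Lemma sformD x y z : B (x + y) z = B x z + B y z.
Proof. by have := sform_linear B 1 x y z; rewrite scale1r mul1r. Qed.

Lemma sform0 z : B 0 z = 0.
Proof. by apply: (addrI (B 0 z)); rewrite -sformD !addr0. Qed.

Lemma sformZ a x z : B (a *: x) z = a * B x z.
Proof. by have := sform_linear B a x 0 z; rewrite sform0 !addr0. Qed.

Lemma sformDr x y z : B z (x + y) = B z x + B z y.
Proof. by rewrite sform_conj sformD rmorphD/= -!sform_conj. Qed.

Lemma sformZr a x z : B z (a *: x) = Num.conj a * B z x.
Proof. by rewrite sform_conj sformZ rmorphM/= -!sform_conj. Qed.

Lemma Re_conj (z : C) : complex.Re (Num.conj z) = complex.Re z.
Proof. by case: z. Qed.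

Lemma snormD_sqr x y :
  snorm (x + y) ^+ 2 = snorm x ^+ 2 + snorm y ^+ 2 + 2 * complex.Re (B x y).
Proof.
have e z : snorm z ^+ 2 = complex.Re (B z z) by rewrite -snorm_sqr.
rewrite !e sformD !sformDr [B y x]sform_conj.
have ReD (u v : C) : complex.Re (u + v) = complex.Re u + complex.Re v.
  by case: u; case: v.
by rewrite !ReD Re_conj; ring.
Qed.

Lemma snormZ a x : snorm (a *: x) = rnorm a * snorm x.
Proof.
apply/eqP; rewrite -(@eqrXn2 _ 2) ?mulr_ge0 ?snorm_ge0 ?rnorm_ge0//; apply/eqP.
apply: complexI; rewrite snorm_sqr sformZ sformZr mulrA exprMn rmorphM/= snorm_sqr.
by congr (_ * _); rewrite rmorphXn/= -rnormE normCK.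
Qed.

(** The quadratic t -> |x + t y|^2 is nonnegative on the reals; evaluate it at its minimum. *)
Lemma cauchy_schwarz x y : complex.Re (B x y) <= snorm x * snorm y.
Proof.
have h t : 0 <= snorm x ^+ 2 + t ^+ 2 * snorm y ^+ 2 + 2 * t * complex.Re (B x y).
  have := sqr_ge0 (snorm (x + t%:C *: y)).
  rewrite snormD_sqr snormZ sformZr rnorm_real exprMn real_normK ?num_real//.
  rewrite conj_Creal ?complex_real//.
  have -> : complex.Re (t%:C * B x y) = t * complex.Re (B x y).
    by case: (B x y) => a b /=; rewrite mul0r subr0.
  by rewrite mulrA.
have x0 := snorm_ge0 x; have y0 := snorm_ge0 y.
have [yE|yn] := eqVneq (snorm y) 0.
  rewrite yE mulr0 leNgt; apply/negP => c0.
  (* When |y| = 0 the polynomial is affine, and at this t its value would be -1. *)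
  have := h (- (snorm x ^+ 2 + 1) / (2 * complex.Re (B x y))).
  rewrite yE expr0n /= mulr0 addr0.
  rewrite (_ : 2 * _ * _ = - (snorm x ^+ 2 + 1)); last by field; rewrite gt_eqF.
  by lra.
rewrite leNgt; apply/negP => lt.
have y1 : 0 < snorm y by rewrite lt_def yn y0.
have := h (- complex.Re (B x y) / snorm y ^+ 2).
set c := complex.Re (B x y) in lt *.
rewrite (_ : _ + _ = snorm x ^+ 2 - (c / snorm y) ^+ 2); last by field.
have : snorm x < c / snorm y by rewrite ltr_pdivlMr.
move=> lt'; rewrite leNgt subr_lt0 ltr_sqr ?lt'// nnegrE ltW//.
exact: le_lt_trans lt'.
Qed.

Lemma snormD x y : snorm (x + y) <= snorm x + snorm y.
Proof.
rewrite -ler_sqr ?nnegrE ?addr_ge0 ?snorm_ge0// snormD_sqr sqrrD.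
by have := cauchy_schwarz x y; lra.
Qed.

Lemma snorm_eq0 x : snorm x = 0 -> forall y, B x y = 0.
Proof.
move=> x0 y; apply: rnorm0_eq0.
(* Rescaling x makes the form real, equal to |B x y|^2. *)
have := cauchy_schwarz (Num.conj (B x y) *: x) y.
rewrite snormZ x0 mulr0 mul0r sformZ -normCKC rnormE -rmorphXn/=.
by move=> h; rewrite -ler_sqr ?nnegrE ?rnorm_ge0// expr0n.
Qed.

Definition srange : {pred V -> C^o} := fun f => `[< exists x, f = B x >].

Lemma srangeP f : reflect (exists x, f = B x) (f \in srange).
Proof. exact: asboolP. Qed.

Lemma sform_funE a x y : B (a *: x + y) = a *: (B x : V -> C^o) + B y.
Proof. by apply/funext => z; exact: sform_linear. Qed.

Fact srange_submod : submod_closed srange.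
Proof.
split; first by apply/srangeP; exists 0; apply/funext => z; rewrite sform0.
move=> a f g /srangeP [x ->] /srangeP [y ->]; apply/srangeP.
by exists (a *: x + y); rewrite sform_funE.
Qed.

HB.instance Definition _ :=
  GRing.isSubmodClosed.Build C (V -> C^o) srange srange_submod.

(* The separation of V, realized as the image of x |-> <x, _>. *)
Definition squot : Type := {f : V -> C^o | f \in srange}.

HB.instance Definition _ := SubChoice.on squot.
HB.instance Definition _ := [SubChoice_isSubLmodule of squot by <:].

Fact sclass_subproof x : (B x : V -> C^o) \in srange.
Proof. by apply/srangeP; exists x. Qed.

Definition sclass (x : V) : squot := exist _ (B x) (sclass_subproof x).

Fact srep_subproof (q : squot) : exists x, sclass x = q.
Proof.
by case: q => f fP; have /srangeP [x fE] := fP; exists x; apply: val_inj.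
Qed.

Definition srep (q : squot) : V := projT1 (cid (srep_subproof q)).

Lemma srepK q : sclass (srep q) = q.
Proof. exact: (projT2 (cid (srep_subproof q))). Qed.

Fact sclass_linear : linear sclass.
Proof. by move=> a x y; apply: val_inj; rewrite /= sform_funE. Qed.

HB.instance Definition _ := GRing.isLinear.Build C V squot _ sclass sclass_linear.

Definition sdot (p q : squot) : C := B (srep p) (srep q).

Lemma sdotE x y : sdot (sclass x) (sclass y) = B x y.
Proof.
have e z : B (srep (sclass z)) = B z by have := congr1 val (srepK (sclass z)).
by rewrite /sdot e sform_conj e -sform_conj.
Qed.

Lemma snorm_srep x : snorm (srep (sclass x)) = snorm x.
Proof. by have := sdotE x x; rewrite /sdot /snorm => ->. Qed.

Definition qnorm (q : squot) : C := (snorm (srep q))%:C.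

Lemma qnormE x : qnorm (sclass x) = (snorm x)%:C.
Proof. by rewrite /qnorm snorm_srep. Qed.

Fact qnormD p q : qnorm (p + q) <= qnorm p + qnorm q.
Proof.
by rewrite -(srepK p) -(srepK q) -linearD !qnormE -rmorphD lecR snormD.
Qed.

Fact qnormZ a q : qnorm (a *: q) = `|a| * qnorm q.
Proof. by rewrite -(srepK q) -linearZ !qnormE snormZ rmorphM/= -rnormE. Qed.

Fact qnorm_eq0 q : qnorm q = 0 -> q = 0.
Proof.
rewrite -(srepK q) qnormE -(rmorph0 (real_complex R)) => /complexI/snorm_eq0 h.
by apply: val_inj; apply/funext => y; exact: h.
Qed.

HB.instance Definition _ :=
  Lmodule_isNormed.Build C squot qnormD qnormZ qnorm_eq0.

Lemma rnorm_sclass x : rnorm (sclass x) = snorm x.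
Proof. by apply: complexI; rewrite -rnormE -qnormE. Qed.

Fact sdot_hermitian p q : sdot p q = (-1) ^+ false * Num.conj (sdot q p).
Proof. by rewrite expr0 mul1r /sdot -sform_conj. Qed.

Fact sdot_bilinear : bilinear_for *%R (Num.conj \; *%R) sdot.
Proof.
split=> [q|q] a x y; rewrite -(srepK q) -(srepK x) -(srepK y) -linearP.
  by rewrite !sdotE sform_linear.
by rewrite !sdotE sformDr sformZr.
Qed.

Fact sdot_gt0 q : q != 0 -> 0 < sdot q q.
Proof.
move=> q0; rewrite /sdot -snorm_sqr -(rmorph0 (real_complex R)) ltcR exprn_gt0//.
rewrite lt_def snorm_ge0 andbT; apply: contra q0 => /eqP h.
by apply/eqP/qnorm_eq0; rewrite /qnorm h.
Qed.

HB.instance Definition _ := bilinear_isBilinear.Build C squot squot C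
  *%R (Num.conj \; *%R) sdot sdot_bilinear.
HB.instance Definition _ :=
  @isHermitianSesquilinear.Build C squot false Num.conj sdot sdot_hermitian.
HB.instance Definition _ := isDotProduct.Build C squot sdot sdot_gt0.

Hypothesis scomplete : forall u : nat -> V,
  (forall n, snorm (u n.+1 - u n) <= 2^-1 ^+ n) ->
  exists l, forall e, 0 < e -> exists N, forall n, (N <= n)%N -> snorm (l - u n) <= e.

(** Centres [q n] of small sets of [F] form a sequence covered by [scomplete]; the divisor 4 leaves
    room to pass through a common point of two such sets. *)
Lemma squot_complete (F : set_system squot) : ProperFilter F -> cauchy F -> cvg F.
Proof.
move=> FF /cauchyP cF.
have h2 n : 0 < 2^-1 ^+ n / 4 :> R by rewrite divr_gt0// exprn_gt0// invr_gt0.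
have /choice [q hq] n : exists q : squot, F [set p | rnorm (q - p) < 2^-1 ^+ n / 4].
  have [|q hq] := cF (2^-1 ^+ n / 4 : R)%:C; first by rewrite ltcR.
  by exists q; apply: filterS hq => p; rewrite -ball_normE /= rnormE ltcR.
have qE n (x : squot) : rnorm (x - q n) = snorm (srep x - srep (q n)).
  by rewrite -{1}(srepK x) -{1}(srepK (q n)) -linearB rnorm_sclass.
have [n|l hl] := scomplete (u := srep \o q).
  have [p [/= h h']] := filter_ex (filterI (hq n) (hq n.+1)).
  rewrite /= -qE -(subrKA p) (le_trans (rnormD _ _))//.
  move: h h'; rewrite exprS rnormB; have := h2 n.
  by rewrite (rnormB p); lra.
apply/cvg_ex; exists (sclass l); apply/cvgrPdist_le => e e0.
have eE : e = (complex.Re e)%:C by rewrite RRe_real ?gtr0_real.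
have e0' : 0 < complex.Re e by rewrite -ltcR -eE.
have [N hN] := hl _ (divr_gt0 e0' (ltr0Sn _ 1)).
have half1 : 2^-1 < 1 :> R by rewrite invf_lt1// ltr1n.
have half0 : 0 <= 2^-1 :> R by rewrite invr_ge0.
have [n0 hn0] := geometric_lt 1 half0 half1 (divr_gt0 e0' (ltr0Sn _ 1)).
pose n := maxn N n0.
have hn : 2^-1 ^+ n / 4 <= complex.Re e / 2.
  have : 2^-1 ^+ n <= 2^-1 ^+ n0 :> R by rewrite ler_wiXn2l ?leq_maxr// ltW.
  by have := h2 n; move: hn0; lra.
apply: filterS (hq n) => p /= hp; rewrite rnormE eE lecR.
rewrite -(subrKA (q n)) (le_trans (rnormD _ _))// (splitr (complex.Re e)) lerD//.
  by rewrite -(srepK (q n)) -linearB rnorm_sclass; apply: hN; exact: leq_maxl.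
by rewrite (le_trans (ltW hp)).
Qed.

(** Under [scomplete] the separated quotient is itself the completion, so the canonical map is onto
    and density is immediate. *)
Lemma hilbert_completion : inhabited (hilbertCompletion B).
Proof.
pose cm := HB.pack_for (completeNormedModType C) squot
  (Uniform_isComplete.Build squot squot_complete).
have hE (x : squot) : `|x| ^+ 2 = sdot x x.
  by rewrite -[`|x|]/(qnorm x) /qnorm -rmorphXn/= snorm_sqr.
pose H := @HilbertSpace R cm (sdot : {dot _ for _}) hE.
apply: inhabits.
have dr : dense (range (sclass : V -> H)).
  by move=> O [q Oq] _; exists q; split=> //; exists (srep q); rewrite ?srepK.
pose L : {linear V -> H} := GRing.Linear.clone _ _ _ _ (sclass : V -> H) _.
exact: (@HilbertCompletion R V B H L sdotE dr).
Qed.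

End SemiInner.

(** * The fibres of Hom(r, s) *)

Section Fibre.
Context {R : realType} {CC : twoCstarCategory R} {A B : obj CC}.
Context {r s : arr1 CC A B} {rb : arr1 CC B A}.
Variable (Rr : arr2 (unit1 A) (tens1 rb r)).
Local Notation C := (complex R).
Local Notation "x %:C" := (real_complex R x) : ring_scope.
Local Notation E := (End_unit A).
Local Notation rscal := (@rscal R CC A).
Local Notation X T := (half_turn Rr T).
Local Notation inner T S := (hom_inner Rr T S : E).
Implicit Types T S D : arr2 r s.

Lemma dag_inner T S : dag (inner T S) = inner S T.
Proof. by rewrite !hom_innerE /dag star_vcomp starK. Qed.

Lemma inner_linear a T T' S : inner (a *: T + T') S = a *: inner T S + inner T' S.
Proof. by rewrite !hom_innerE half_turn_linear vcompDr vcompZr. Qed.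

Lemma pos_inner T : pos (inner T T).
Proof. by rewrite hom_innerE; exact: star_vcomp_pos. Qed.

(** Closed with [Defined] so that the form unfolds to [gev w (inner T S)]. *)
Definition hom_semiInner (w : spectrum A) : semiInner (arr2 r s).
Proof.
apply: (@SemiInner _ _ (fun T S => gev w (inner T S))).
- by move=> a T T' S; rewrite inner_linear scaleE rmorphD rmorphM/= gev_scal.
- by move=> T S; rewrite -gev_dag dag_inner.
- move=> T; have [x x0 ->] := gev_pos w (pos_inner T).
  by rewrite -(rmorph0 (real_complex R)) lecR.
Defined.

Lemma gev_inner w T : gev w (inner T T) = (snorm (hom_semiInner w) T ^+ 2)%:C.
Proof. by rewrite snorm_sqr. Qed.

Lemma snorm_le_half_turn w T : snorm (hom_semiInner w) T <= rnorm (X T).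
Proof.
rewrite -ler_sqr ?nnegrE ?rnorm_ge0 ?snorm_ge0// -rnorm_star_vcomp -hom_innerE.
have := rnorm_gev w (inner T T).
by rewrite gev_inner rnorm_real ger0_norm ?sqr_ge0.
Qed.

Hypothesis hsum : closed_under_direct_sums CC.

(** With [snorm_le_half_turn]: |X_T| is controlled exactly by the fibre norms. Here <T, T> = Y^* Y
    with Y in End(iota_A), and [rnorm_sqr_le] bounds |Y|. *)
Lemma rnorm_half_turn_le T (e : R) : 0 <= e ->
  (forall w, snorm (hom_semiInner w) T <= e) -> rnorm (X T) <= e.
Proof.
move=> e0 h; rewrite -ler_sqr ?nnegrE ?rnorm_ge0// -rnorm_star_vcomp -hom_innerE.
have [Y hY] := pos_inner T; rewrite [hom_inner _ _ _]hY rnorm_dag_mul.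
apply: (rnorm_sqr_le hsum); first exact: sqr_ge0.
move=> w; rewrite -lecR -gev_dag_mul -hY gev_inner lecR.
by rewrite ler_sqr ?nnegrE ?snorm_ge0.
Qed.

Lemma half_turnB T S : X (T - S) = X T - X S.
Proof. by have := linear_add (@half_turn_linear _ _ _ _ _ _ Rr s) T (- S);
  rewrite (linear_opp (@half_turn_linear _ _ _ _ _ _ Rr s)). Qed.

Lemma gev_inner_vcomp w T S (a : E) : X S = vcomp (X T) a ->
  gev w (inner S S) = (rnorm (gev w a) ^+ 2)%:C * gev w (inner T T).
Proof.
move=> XS; rewrite !hom_innerE XS star_vcomp -vcompA (vcompA (star (X T))).
rewrite -[vcomp (star a) _]/(dag a * ((vcomp (star (X T)) (X T) : E) * a)).
by rewrite mulrCA mulrC rmorphM/= gev_dag_mul.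
Qed.

(* With d = <D, D>, the multiplier (e^2 + d(w)) / (e^2 + d) has value 1 at w
   and compresses D to norm at most e. *)
Lemma compress w D (e : R) : 0 < e -> snorm (hom_semiInner w) D <= e ->
  exists D', rnorm (X D') <= e /\ snorm (hom_semiInner w) (D - D') = 0.
Proof.
move=> e0 he; set d := inner D D.
have [||q hq] := @pos_invertible _ _ _ hsum (rscal (e ^+ 2) + d) (e ^+ 2).
- exact: exprn_gt0.
- by rewrite addrC addKr; exact: pos_inner.
have e2 : 0 < e ^+ 2 by exact: exprn_gt0.
set x := snorm (hom_semiInner w) D in he.
have gq t : gev t q = ((e ^+ 2 + snorm (hom_semiInner t) D ^+ 2)^-1)%:C.
  move/(congr1 (gev t)): hq; rewrite rmorphM rmorphD rmorph1/= gev_rscal gev_inner.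
  rewrite -rmorphD; set y := e ^+ 2 + _ => h.
  have y0 : y != 0 by rewrite gt_eqF// ltr_pwDl// sqr_ge0.
  have y0' : y%:C != 0 by rewrite -(rmorph0 (real_complex R)) (inj_eq (@complexI R)).
  by apply: (mulfI y0'); rewrite h -rmorphM mulfV// rmorph1.
pose f := rscal (e ^+ 2 + x ^+ 2) * q.
have gf t : gev t f = ((e ^+ 2 + x ^+ 2) / (e ^+ 2 + snorm (hom_semiInner t) D ^+ 2))%:C.
  by rewrite /f rmorphM/= gev_rscal gq -rmorphM.
exists (hom_act D f); split.
  apply: rnorm_half_turn_le => [|t]; first exact: ltW.
  rewrite -ler_sqr ?nnegrE ?snorm_ge0 ?(ltW e0)// -lecR -gev_inner.
  rewrite (gev_inner_vcomp t (half_turn_act Rr D f)) gf gev_inner -rmorphM lecR.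
  rewrite rnorm_real real_normK ?num_real//.
  set y := snorm (hom_semiInner t) D ^+ 2.
  have y0 : 0 <= y by exact: sqr_ge0.
  have y1 : 0 < e ^+ 2 + y by rewrite ltr_pwDl.
  (* Since x <= e the numerator is at most 2 e^2, and 4 e^2 y <= (e^2 + y)^2. *)
  rewrite expr_div_n mulrAC ler_pdivrMr ?exprn_gt0//.
  have xe : x ^+ 2 <= e ^+ 2 by rewrite ler_sqr ?nnegrE ?snorm_ge0// ltW.
  have h1 : (e ^+ 2 + x ^+ 2) ^+ 2 <= (2 * e ^+ 2) ^+ 2.
    rewrite ler_sqr ?nnegrE ?mulr_ge0 ?addr_ge0 ?sqr_ge0//; lra.
  rewrite (le_trans (ler_wpM2r y0 h1))//.
  rewrite (_ : _ * y = e ^+ 2 * (4 * e ^+ 2 * y)); last by ring.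
  rewrite ler_pM2l// -subr_ge0 (_ : _ - _ = (e ^+ 2 - y) ^+ 2); last by ring.
  exact: sqr_ge0.
have XE : X (D - hom_act D f) = vcomp (X D) (1 - f).
  by rewrite half_turnB half_turn_act vcompBr -id2_oneE vcomp1r.
apply/eqP; rewrite -sqrf_eq0 -(inj_eq (@complexI R)) -gev_inner.
rewrite (gev_inner_vcomp w XE) rmorphB rmorph1/= gf mulfV ?rmorph1 ?subrr ?rnorm0.
  by rewrite expr0n rmorph0 mul0r.
by rewrite gt_eqF// ltr_pwDl// sqr_ge0.
Qed.

Context {Rb : arr2 (unit1 B) (tens1 r rb)}.
Hypothesis conj : conjugation_equations Rr Rb.

Lemma half_geometric (V : completeNormedModType C) (c : R) (u : nat -> V) :
  (forall n, rnorm (u n.+1 - u n) <= c * 2^-1 ^+ n) ->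
  exists l, forall e, 0 < e -> exists N, forall n, (N <= n)%N -> rnorm (l - u n) <= e.
Proof.
move=> hu.
have half1 : 2^-1 < 1 :> R by rewrite invf_lt1// ltr1n.
have half0 : 0 <= 2^-1 :> R by rewrite invr_ge0.
have c0 : 0 <= c.
  by have := hu 0%N; rewrite expr0 mulr1; apply: le_trans; exact: rnorm_ge0.
have [l hl] := geometric_cvg half0 half1 hu.
exists l => e e0; have [N hN] := geometric_lt (c / (1 - 2^-1)) half0 half1 e0.
exists N => n Nn; rewrite (le_trans (hl n))// mulrAC (le_trans _ (ltW hN))//.
rewrite ler_wpM2l ?divr_ge0 ?subr_ge0 ?(ltW half1)//.
by rewrite ler_wiXn2l// ltW.
Qed.

(** Each increment is replaced by one equal to it at w but small in [Hom(r, s)]; the modified series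
    converges there, and its limit serves in the fibre. *)
Lemma hom_fibre_complete w (u : nat -> arr2 r s) :
  (forall n, snorm (hom_semiInner w) (u n.+1 - u n) <= 2^-1 ^+ n) ->
  exists l, forall e, 0 < e -> exists N, forall n, (N <= n)%N ->
    snorm (hom_semiInner w) (l - u n) <= e.
Proof.
move=> hu; have h0 n : 0 < 2^-1 ^+ n :> R by rewrite exprn_gt0// invr_gt0.
have [D' hD'] := choice (fun n => compress (h0 n) (hu n)).
pose v n := u 0%N + \sum_(k < n) D' k.
have vu n : snorm (hom_semiInner w) (v n - u n) = 0.
  elim: n => [|n IH].
    rewrite /v big_ord0 addr0 subrr -(scale0r (u 0%N)) snormZ.
    by rewrite rnorm0 mul0r.
  apply: le_anti; rewrite snorm_ge0 andbT.
  rewrite (_ : v n.+1 - u n.+1 = (v n - u n) + (-1) *: (u n.+1 - u n - D' n)).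
    rewrite (le_trans (snormD _ _ _))// snormZ IH (hD' n).2 mulr0 addr0//.
  by rewrite /v big_ord_recr /= scaleN1r addrA opprB opprB addrACA addKr.
have [K K0 hK] := rnorm_le_half_turn s hsum conj.
have [n|l hl] := @half_geometric _ K v.
  rewrite /v big_ord_recr /= addrA [_ - _]addrC addKr (le_trans (hK _))//.
  by rewrite ler_wpM2l// (hD' n).1.
exists l => e e0.
(* The constant of [rnorm_half_turn], plus 1 so that it can be divided by. *)
have R1 : 0 < 2 * rnorm Rr + 1 by rewrite ltr_wpDl// mulr_ge0// rnorm_ge0.
have [N hN] := hl _ (divr_gt0 e0 R1).
exists N => n Nn; rewrite -(subrKA (v n)) (le_trans (snormD _ _ _))// vu addr0.
rewrite (le_trans (snorm_le_half_turn _ _))//.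
rewrite (le_trans (rnorm_half_turn _ _ hsum))//.
have h1 := hN n Nn; rewrite ler_pdivlMr// mulrC in h1.
rewrite (le_trans _ h1)// ler_wpM2r ?rnorm_ge0//.
by rewrite lerDl.
Qed.

Lemma hom_fibre_exists : inhabited (forall w : spectrum A, hom_fibre s Rr w).
Proof.
have h w : exists H : hom_fibre s Rr w, True.
  have [H] := hilbert_completion (@hom_fibre_complete w).
  by exists H.
by apply: inhabits => w; exact: (projT1 (cid (h w))).
Qed.

End Fibre.

(** * The bundle *)

Section Bundle.
Context {R : realType} {CC : twoCstarCategory R} {A B : obj CC}.
Context {r s : arr1 CC A B} {rb : arr1 CC B A}.
Context {Rr : arr2 (unit1 A) (tens1 rb r)} {Rb : arr2 (unit1 B) (tens1 r rb)}.
Hypothesis hsum : closed_under_direct_sums CC.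
Hypothesis conj : conjugation_equations Rr Rb.
Variable H : forall w : spectrum A, hom_fibre s Rr w.
Local Notation C := (complex R).
Local Notation "x %:C" := (real_complex R x) : ring_scope.
Local Notation E := (End_unit A).
Local Notation rscal := (@rscal R CC A).
Local Notation scal := (@scal R CC A).
Local Notation X T := (half_turn Rr T).
Local Notation W := (spectrum A).
Implicit Types T S D : arr2 r s.

Lemma rnorm_hc_map (w : W) T : rnorm (hc_map (H w) T) = snorm (hom_semiInner Rr w) T.
Proof.
apply/eqP; rewrite -(@eqrXn2 _ 2) ?snorm_ge0 ?rnorm_ge0//; apply/eqP.
apply: complexI; rewrite [LHS]rmorphXn/= -rnormE hnormE hc_dot.
by rewrite [RHS]snorm_sqr.
Qed.

Lemma rnorm_hc_map_le (w : W) T : rnorm (hc_map (H w) T) <= rnorm (X T).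
Proof. by rewrite rnorm_hc_map snorm_le_half_turn. Qed.

(** The difference is the class of T (a - a(w)), whose norm at w carries the factor |a(w) - a(w)| =
    0. *)
Lemma hc_map_act (w : W) T (a : E) :
  hc_map (H w) (hom_act T a) = gev w a *: hc_map (H w) T.
Proof.
apply/eqP; rewrite -subr_eq0 -linearZ -linearB; apply/eqP/rnorm_eq0.
rewrite rnorm_hc_map.
have XE : X (hom_act T a - gev w a *: T) = vcomp (X T) (a - scal (gev w a)).
  rewrite half_turnB half_turn_act (linear_scale (@half_turn_linear _ _ _ _ _ _ Rr s)).
  by rewrite vcompBr vcompZr -id2_oneE vcomp1r.
apply/eqP; rewrite -sqrf_eq0 -(inj_eq (@complexI R)) -gev_inner.
rewrite (gev_inner_vcomp w XE) rmorphB/= gev_scal subrr rnorm0.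
by rewrite expr0n rmorph0 mul0r.
Qed.

Lemma hc_map_norm_continuous T :
  continuous (fun w : W => `|hc_map (H w) T| : C^o).
Proof.
move=> v; have FF := @nbhs_filter (spectrum A) v.
apply: (iffRL (@cvgrPdist_lt _ _ _ _ FF _ _)) => e e0.
have eE : e = (complex.Re e)%:C by rewrite RRe_real ?gtr0_real.
have e0' : 0 < complex.Re e by rewrite -ltcR -eE.
have e2 : 0 < complex.Re e ^+ 2 by rewrite exprn_gt0.
apply: (@filterS _ _ FF _ _ _ (nbhs_gev (hom_inner Rr T T : E) v e2)) => w /=.
rewrite !gev_inner -rmorphB rnorm_real => h.
rewrite [`|hc_map (H v) T|]rnormE [`|hc_map (H w) T|]rnormE !rnorm_hc_map.
rewrite -rmorphB [`|_|]rnormE rnorm_real eE ltcR.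
set a := snorm (hom_semiInner Rr v) T; set b := snorm (hom_semiInner Rr w) T.
rewrite -/a -/b in h.
(* From |a - b| <= a + b one gets |a - b|^2 <= |a^2 - b^2|, and the squared norms are continuous as
   values of <T, T>. *)
rewrite -ltr_sqr ?nnegrE ?(ltW e0')// (le_lt_trans _ h)// distrC.
rewrite subr_sqr normrM expr2 ler_pM//.
rewrite (@ger0_norm _ (b + a)) ?addr_ge0 ?snorm_ge0// ler_norml.
by have := snorm_ge0 (hom_semiInner Rr w) T; have := snorm_ge0 (hom_semiInner Rr v) T;
  rewrite -/a -/b; lra.
Qed.

(** * Sections that are locally approximable come from Hom(rho, sigma) *)

Section Local.
Variable x : forall w : W, H w.
Hypothesis xloc : forall (w : W) (e : R), 0 < e -> exists T,
  \forall w' \near w, rnorm (x w' - hc_map (H w') T) < e.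

(* Partition of unity with weights u_v^N / sum_v u_v^N : the points at which
   x is far from T_v have weight at most (3/4)^N. *)
Lemma global_approx (e : R) : 0 < e ->
  exists T, forall w, rnorm (x w - hc_map (H w) T) <= e.
Proof.
move=> e0; have e2 : 0 < e / 2 by rewrite divr_gt0.
have [T hT] := choice (fun v => xloc v e2).
have [u hu] := choice (fun v => spectrum_bump hsum (hT v)).
pose rho v t := complex.Re (gev t (u v)).
have hrho v t : [/\ 0 <= rho v t, rho v t <= 1, gev t (u v) = (rho v t)%:C &
    2^-1 < rho v t -> rnorm (x t - hc_map (H t) (T v)) < e / 2].
  by have [_ _ /(_ t) [y [h1 h2 h3 h4]]] := hu v; rewrite /rho h3; split.
have third : 0 < 3^-1 :> R by rewrite invr_gt0.
(* Every point has some weight at least 2/3, while weights at bad points are at most 1/2; the ratio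
   of these bounds is 3/4. *)
have [v|sq hs] := @spectrum_cover _ _ _
    (fun v => [set t | rnorm (gev t (u v) - gev v (u v)) < 3^-1]).
  exact: nbhs_gev.
have {}hs t : exists2 v, v \in sq & 2 / 3 <= rho v t.
  have [v vs /= h] := hs t; exists v => //; move: h.
  have [_ -> _] := hu v; have [_ r1 -> _] := hrho v t.
  rewrite -(rmorph1 (real_complex R)) -rmorphB rnorm_real ltr_norml => /andP[h _].
  by lra.
pose M := \sum_(v <- sq) rnorm (X (T v)).
have MT v : v \in sq -> rnorm (X (T v)) <= M.
  move=> vs; rewrite /M (perm_big _ (perm_to_rem vs)) big_cons lerDl.
  by apply: sumr_ge0 => i _; exact: rnorm_ge0.
have M0 : 0 <= M by apply: sumr_ge0 => i _; exact: rnorm_ge0.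
(* A bound for |x - T_v| at all points, good or bad: pass through a [T v'] that is close to x
   there. *)
pose K := e / 2 + M + M.
have K0 : 0 <= K by rewrite !addr_ge0// ltW.
have xK v t : v \in sq -> rnorm (x t - hc_map (H t) (T v)) <= K.
  move=> vs; have [v' vs' rv'] := hs t; have [_ _ _ near] := hrho v' t.
  have {}near : rnorm (x t - hc_map (H t) (T v')) <= e / 2.
    by apply/ltW/near; lra.
  rewrite -(subrKA (hc_map (H t) (T v'))) (le_trans (rnormD _ _))// /K -addrA lerD//.
  rewrite (le_trans (rnormD _ _))// rnormN lerD//.
    by rewrite (le_trans (rnorm_hc_map_le _ _))// MT.
  by rewrite (le_trans (rnorm_hc_map_le _ _))// MT.
have [N hN] : exists N, ((size sq)%:R * K) * (3 / 4) ^+ N < e / 2.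
  by apply: geometric_lt => //; lra.
pose Sig := \sum_(v <- sq) u v ^+ N.
pose sig t := \sum_(v <- sq) rho v t ^+ N.
have gSig t : gev t Sig = (sig t)%:C.
  rewrite /Sig /sig !rmorph_sum/=; apply: eq_bigr => v _.
  by rewrite !rmorphXn/=; have [_ _ ->] := hrho v t.
have sig_ge t : (2 / 3) ^+ N <= sig t.
  have [v vs rv] := hs t.
  rewrite /sig (perm_big _ (perm_to_rem vs)) big_cons.
  apply: ler_wpDr; last by rewrite lerXn2r// nnegrE; lra.
  by apply: sumr_ge0 => i _; rewrite exprn_ge0//; have [] := hrho i t.
have c0 : 0 < (2 / 3) ^+ N :> R by rewrite exprn_gt0//; lra.
have hSig : herm Sig by apply: herm_sum => v; apply: herm_exp; have [] := hu v.
(* The lower bound of [sig] is halved because [pos_of_gev] asks for strict positivity. *)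
have [||q Sq] := @pos_invertible _ _ _ hsum Sig ((2 / 3) ^+ N / 2).
- by rewrite divr_gt0.
- apply: (pos_of_gev hsum); first by apply: hermB => //; exact: herm_rscal.
  move=> w; rewrite rmorphB/= gSig gev_rscal -rmorphB -(rmorph0 (real_complex R)) ltcR.
  by have := sig_ge w; lra.
have sig0 t : 0 < sig t by exact: lt_le_trans (sig_ge t).
pose h v := u v ^+ N * q.
have gh v t : gev t (h v) = (rho v t ^+ N / sig t)%:C.
  rewrite /h rmorphM rmorphXn/=; have [_ _ -> _] := hrho v t.
  rewrite rmorphM rmorphXn/=; congr (_ * _).
  have s0 : (sig t)%:C != 0.
    by rewrite -(rmorph0 (real_complex R)) (inj_eq (@complexI R)) gt_eqF.
  apply: (mulfI s0); rewrite -[RHS]rmorphM mulfV ?gt_eqF// rmorph1 -gSig.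
  by rewrite -(rmorphM (gev t)) Sq rmorph1.
exists (\sum_(v <- sq) hom_act (T v) (h v)) => w.
have -> : x w - hc_map (H w) (\sum_(v <- sq) hom_act (T v) (h v)) =
    \sum_(v <- sq) (rho v w ^+ N / sig w)%:C *: (x w - hc_map (H w) (T v)).
  rewrite linear_sum/= -[in LHS](scale1r (x w)).
  have -> : 1 = \sum_(v <- sq) (rho v w ^+ N / sig w)%:C.
    by rewrite -rmorph_sum/= -mulr_suml -/(sig w) mulfV ?rmorph1// gt_eqF.
  rewrite scaler_suml -sumrB; apply: eq_bigr => v _.
  by rewrite hc_map_act gh scalerBr.
rewrite (le_trans (rnorm_sum _ _))//.
have q34 : (2^-1) ^+ N / (2 / 3) ^+ N = (3 / 4) ^+ N :> R.
  by rewrite -expr_div_n; congr (_ ^+ _); field.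
have term v : v \in sq ->
    rnorm ((rho v w ^+ N / sig w)%:C *: (x w - hc_map (H w) (T v))) <=
    rho v w ^+ N / sig w * (e / 2) + K * (3 / 4) ^+ N.
  move=> vs; have [r0 r1 _ near] := hrho v w.
  have rN0 : 0 <= rho v w ^+ N / sig w by rewrite divr_ge0 ?exprn_ge0// ltW.
  have k34 : 0 <= K * (3 / 4) ^+ N by rewrite mulr_ge0// exprn_ge0//; lra.
  rewrite rnormZ rnorm_real ger0_norm//.
  have [/near/ltW h1|far] := ltP 2^-1 (rho v w).
    by rewrite (le_trans (ler_wpM2l rN0 h1))// lerDl.
  have h2 : rho v w ^+ N / sig w <= (3 / 4) ^+ N.
    rewrite -q34 ler_pM ?exprn_ge0 ?invr_ge0 ?(ltW (sig0 w))//.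
      by rewrite lerXn2r ?nnegrE ?invr_ge0.
    by rewrite lef_pV2 ?posrE.
  rewrite (le_trans (ler_pM rN0 (rnorm_ge0 _) h2 (xK _ _ vs)))// mulrC lerDr.
  by rewrite mulr_ge0// ltW.
rewrite big_seq (le_trans (ler_sum _ term))// -big_seq big_split/=.
rewrite -mulr_suml -mulr_suml -/(sig w) mulfV ?gt_eqF// mul1r [leRHS]splitr lerD2l.
rewrite big_const_seq count_predT iter_addr_0 -[leLHS]mulr_natl mulrA.
exact: ltW.
Qed.

(** Global approximations with errors 2^-n form a Cauchy sequence in [Hom(r, s)] by norm
    equivalence; its limit induces x. *)
Lemma local_is_section : exists T, x = hom_section H T.
Proof.
have h0 n : 0 < 2^-1 ^+ n :> R by rewrite exprn_gt0// invr_gt0.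
have [u hu] := choice (fun n => global_approx (h0 n)).
have [K K0 hK] := rnorm_le_half_turn s hsum conj.
(* In each fibre consecutive approximations differ by at most 2^-(n+1) + 2^-n <= 2 * 2^-n. *)
have [n|l hl] := @half_geometric _ _ (K * 2) u.
  rewrite (le_trans (hK _))// -mulrA ler_wpM2l//.
  apply: (rnorm_half_turn_le hsum); first by rewrite mulr_ge0// ltW.
  move=> w; rewrite -rnorm_hc_map linearB/= -(subrKA (x w)).
  rewrite (le_trans (rnormD _ _))// mulr_natl mulr2n lerD//.
  rewrite rnormB (le_trans (hu n.+1 w))// exprS ler_piMl ?(ltW (h0 n))//.
  by rewrite invf_le1// ler1n.
exists l; apply: functional_extensionality_dep => w; apply/eqP; rewrite -subr_eq0; apply/eqP.
apply: rnorm0_eq0; apply: rnorm_closure => d d0; rewrite add0r.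
have R1 : 0 < 2 * rnorm Rr + 1 by rewrite ltr_wpDl// mulr_ge0// rnorm_ge0.
have d2 : 0 < d / 2 by rewrite divr_gt0.
have [N hN] := hl _ (divr_gt0 d2 R1).
have [N' hN'] : exists N', 1 * 2^-1 ^+ N' < d / 2.
  by apply: geometric_lt; rewrite ?invr_ge0// invf_lt1// ltr1n.
pose n := maxn N N'.
rewrite -(subrKA (hc_map (H w) (u n))) (le_trans (rnormD _ _))// (splitr d) lerD//.
  rewrite (le_trans (hu n w))// (le_trans _ (ltW hN'))// mul1r.
  by rewrite ler_wiXn2l ?leq_maxr ?invr_ge0// invf_le1// ler1n.
rewrite /hom_section rnormB -linearB (le_trans (rnorm_hc_map_le _ _))//.
rewrite (le_trans (rnorm_half_turn _ _ hsum))//.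
have := hN n (leq_maxl _ _); rewrite ler_pdivlMr// mulrC => h1.
rewrite (le_trans _ h1)// ler_wpM2r ?rnorm_ge0//.
by rewrite lerDl.
Qed.

End Local.
End Bundle.

Theorem proposition2p2 (R : realType) (CC : twoCstarCategory R)
    (hproj : closed_under_projections CC)
    (hsum : closed_under_direct_sums CC)
    (hconj : closed_under_conjugation CC)
    (A B : obj CC) (rho sigma : arr1 CC A B) (rhob : arr1 CC B A)
    (Rr : arr2 (unit1 A) (tens1 rhob rho))
    (Rb : arr2 (unit1 B) (tens1 rho rhob))
    (hR : conjugation_equations Rr Rb) :
  (* the fibres Hom(rho, sigma)_w exist *)
  inhabited (forall w : spectrum A, hom_fibre sigma Rr w) /\
  (* and for any choice of them *)
  forall H : forall w : spectrum A, hom_fibre sigma Rr w,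
    let Gamma := range (hom_section H) in
    [/\ is_hilbert_bundle Gamma,
        forall (a : complex R) (T S : arr2 rho sigma),
          hom_section H (a *: T + S) =
          (fun w => a *: hom_section H T w + hom_section H S w) &
        set_bij [set: arr2 rho sigma] Gamma (hom_section H)].
Proof.
split; first exact: (hom_fibre_exists hsum hR).
move=> H Gamma.
have lin (a : complex R) (T S : arr2 rho sigma) : hom_section H (a *: T + S) =
    (fun w => a *: hom_section H T w + hom_section H S w).
  by apply: functional_extensionality_dep => w; exact: linearP.
split=> //.
- split.
  + exact: spectrum_compact.
  + exact: spectrum_hausdorff.
  + exists 0 => //; apply: functional_extensionality_dep => w; exact: linear0.
  + by move=> a _ _ [T _ <-] [S _ <-]; exists (a *: T + S).
  + move=> w O O0 oO; have [y [Oy [T _ Ty]]] := @hc_dense _ _ _ (H w) O O0 oO.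
    exists y; split=> //; rewrite -Ty.
    by exists (hom_section H T) => //; exists T.
  + by move=> _ [T _ <-]; exact: hc_map_norm_continuous.
  + move=> x hx; have [|T ->] := local_is_section hsum hR (H := H) (x := x).
      move=> w e e0; have [_ [T _ <-] hT] := hx w e e0.
      exists T; have FF := @nbhs_filter (spectrum A) w.
      apply: (@filterS _ _ FF _ _ _ hT) => w' /=.
      by rewrite rnormE ltcR.
    by exists T.
- split=> //; first by move=> T _; exists T.
  (* Injectivity: if T - S vanishes in every fibre, then X_{T-S} = 0, hence T - S = 0. *)
  move=> T S _ _ TS; apply/eqP; rewrite -subr_eq0; apply/eqP/rnorm0_eq0.
  have [K K0 hK] := rnorm_le_half_turn sigma hsum hR.
  rewrite (le_trans (hK _))//.
  suff -> : half_turn Rr (T - S) = 0 by rewrite rnorm0 mulr0.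
  apply/rnorm0_eq0/(rnorm_half_turn_le hsum) => // w.
  rewrite -(rnorm_hc_map H) linearB/= (_ : hc_map (H w) T = hc_map (H w) S).
    by rewrite subrr rnorm0.
  exact: (congr1 (fun X => X w) TS).
Qed.
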